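(* For every integer $l\ge 1$, there is exactly one free crystallized polyomino $A$ with $h(A)=(2^{2l}-1)/3$.
   Context: A polyomino is a finite union of closed unit squares (tiles) of the square lattice, any two meeting (if at all) in a whole edge, whose interior is connected. Its holes are the bounded connected components of its complement in the plane; $h(A)$ is the number of holes and $|A|$ the number of tiles. For $h\ge1$, $g(h)=\min\{|A|: h(A)=h\}$, and a polyomino with $h$ holes is crystallized if it has $g(h)$ tiles. Free polyominoes are polyominoes considered up to translations, rotations and reflections. *)

(* Defs.v *)
From HB Require Import structures.
From mathcomp Require Import all_boot all_order all_algebra.
From mathcomp Require Import finmap.
Set Implicit Arguments. Unset Strict Implicit. Unset Printing Implicit Defensive.
Import Order.TTheory GRing.Theory Num.Theory.
Local Open Scope fset_scope.

(* A cell (closed unit square) of the square lattice, identified by the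
   integer coordinates of its lower-left corner. *)
Definition cell := (int * int)%type.

Definition adj (p q : cell) : bool :=
  (absz (p.1 - q.1)%R + absz (p.2 - q.2)%R == 1)%N.

Definition conn (S : pred cell) (p q : cell) : Prop :=
  S p /\ exists s : seq cell, [&& path adj p s, all S s & last p s == q].

(* A polyomino: a nonempty finite set of tiles whose union has connected
   interior, i.e. the tiles are edge-connected. *)
Definition polyomino (A : {fset cell}) : Prop :=
  A != fset0 /\ forall p q, p \in A -> q \in A -> conn (mem A) p q.

Definition compl (A : {fset cell}) : pred cell := fun c => c \notin A.

Definition enclosed (A : {fset cell}) (c : cell) : Prop :=
  c \notin A /\ exists N : nat, forall d, conn (compl A) c d ->
    (absz d.1 <= N)%N /\ (absz d.2 <= N)%N.

Definition num_holes (A : {fset cell}) (h : nat) : Prop :=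
  exists reps : seq cell,
    [/\ size reps = h,
        forall r, r \in reps -> enclosed A r,
        forall i j, (i < h)%N -> (j < h)%N -> i <> j ->
          ~ conn (compl A) (nth (0%R, 0%R) reps i) (nth (0%R, 0%R) reps j)
      & forall c, enclosed A c -> exists2 r, r \in reps & conn (compl A) r c].

Definition crystallized (h : nat) (A : {fset cell}) : Prop :=
  [/\ polyomino A, num_holes A h &
      forall B : {fset cell}, polyomino B -> num_holes B h -> (#|` A| <= #|` B|)%N].

(* The 8 symmetries of the square lattice followed by a translation. *)
Definition isom (swap sx sy : bool) (t : cell) (c : cell) : cell :=
  let uv := if swap then (c.2, c.1) else c in
  (((if sx then - uv.1 else uv.1) + t.1)%R, ((if sy then - uv.2 else uv.2) + t.2)%R).

Definition free_equiv (A B : {fset cell}) : Prop :=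
  exists (swap sx sy : bool) (t : cell), B = [fset isom swap sx sy t c | c in A].

(* Main.v *)
Require Import Defs.
From mathcomp Require Import all_boot all_order all_algebra.
From mathcomp Require Import finmap.
From mathcomp Require Import zify boolp.
Set Implicit Arguments. Unset Strict Implicit. Unset Printing Implicit Defensive.
Import Order.TTheory GRing.Theory Num.Theory.
Local Open Scope fset_scope.
Local Open Scope nat_scope.

(** Let [M = 2 ^ l], so that [3h + 1 = M ^ 2].  A connected set of [n] tiles has
    perimeter at most [2n + 2]; filling the [h] holes removes at least [4h] from
    the perimeter and leaves at least the perimeter of a bounding rectangle.
    With AM-GM this gives [n + h >= M ^ 2 + 2M].  In case of equality the tiles
    form a tree, the holes are single cells, and the filled polyomino is an
    [(M + 1) * (M + 1)] square without a corner: the full [M * (M + 2)] rectangle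
    is excluded because the complement of a forest of tiles is connected under
    king moves.

    Call the holes and the missing corner [(0, 0)] white.  White cells are
    connected by diagonal steps, so they have even coordinate sum.  Black cells
    with even coordinate sum and odd coordinates are never joined to the border,
    so all cells with two odd coordinates are white; and the cells with two even
    coordinates form a configuration of the same kind on the square of side
    [M / 2].  By induction on [l] the configuration is unique. *)

(** * Perimeter and edge-connectivity *)

Definition dirs : seq cell := [:: (1, 0); (-1, 0); (0, 1); (0, -1)]%R.

Lemma dirs_opp (u : cell) : u \in dirs -> (- u)%R \in dirs.
Proof. by rewrite !inE => /or4P[] /eqP->. Qed.

Lemma dirs_neq0 (u : cell) : u \in dirs -> u != 0%R.
Proof. by rewrite !inE => /or4P[] /eqP->. Qed.

Lemma adjP (p q : cell) : reflect (exists2 u, u \in dirs & q = (p + u)%R) (adj p q).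
Proof.
apply: (iffP idP) => [pq|[u + ->]].
  exists (q - p)%R; last by rewrite addrC subrK.
  case: p q pq => [a b] [c d]; rewrite /adj /= !inE !xpair_eqE /=.
  lia.
case: p => a b; rewrite !inE /adj => /or4P[] /eqP-> /=; lia.
Qed.

Lemma conn_refl (S : pred cell) (p : cell) : S p -> conn S p p.
Proof. by move=> Sp; split=> //; exists [::]; rewrite /= eqxx. Qed.

Lemma conn_trans (S : pred cell) (p q r : cell) : conn S p q -> conn S q r -> conn S p r.
Proof.
case=> Sp [s /and3P[ps sS /eqP ls]] [_ [t /and3P[qt tS lt]]].
split=> //; exists (s ++ t).
by rewrite cat_path all_cat last_cat ps sS tS ls qt lt.
Qed.

Lemma conn_step (S : pred cell) (p u : cell) :
  S p -> S (p + u)%R -> u \in dirs -> conn S p (p + u)%R.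
Proof.
move=> Sp Spu uD; split=> //; exists [:: (p + u)%R].
by rewrite /= Spu eqxx /= !andbT; apply/adjP; exists u.
Qed.

Lemma conn_colour (S : pred cell) (T : eqType) (f : cell -> T) :
  (forall p u, S p -> u \in dirs -> S (p + u)%R -> f (p + u)%R = f p) ->
  forall p q, conn S p q -> f q = f p.
Proof.
move=> fS p q [+ [s /and3P[+ + /eqP<-]]].
elim: s p => //= r s IHs p Sp /andP[/adjP[u uD ->] rs] /andP[Sr sS].
by rewrite (IHs _ Sr rs sS) fS.
Qed.

(** The colouring to test is the truth value of being connected to [p]. *)
Lemma colour_conn (S : pred cell) :
  (forall f : cell -> bool, (forall p u, S p -> u \in dirs -> S (p + u)%R -> f (p + u)%R = f p) ->
     forall p q, S p -> S q -> f q = f p) ->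
  forall p q, S p -> S q -> conn S p q.
Proof.
move=> colS p q Sp Sq; apply/asboolP.
rewrite (colS (fun c => `[< conn S p c >]) _ p q Sp Sq); first exact/asboolP/conn_refl.
move=> {Sq}c u Sc uD Scu; apply: asbool_equiv_eq; split=> pc; apply: conn_trans pc _.
  by have:= @conn_step S (c + u)%R (- u)%R Scu; rewrite addrK; apply=> //; apply: dirs_opp.
exact: conn_step.
Qed.

Lemma conn_sym (S : pred cell) (p q : cell) : conn S p q -> conn S q p.
Proof.
move=> pq; have [Sp _] := pq; apply/asboolP.
rewrite (@conn_colour S _ (fun c => `[< conn S c p >]) _ _ _ pq) => [|c u Sc uD Scu].
  by apply/asboolP/conn_refl.
apply: asbool_equiv_eq; split; apply: conn_trans.
  exact: conn_step.
by have:= @conn_step S (c + u)%R (- u)%R Scu; rewrite addrK; apply=> //; apply: dirs_opp.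
Qed.

(** An element stands for a boundary edge facing [u], so [per] is the usual perimeter, sorted by
    direction. *)
Definition exits (F : {fset cell}) (u : cell) : {fset cell} :=
  [fset p in F | (p + u)%R \notin F].

Definition per (F : {fset cell}) : nat := \sum_(u <- dirs) #|` exits F u|.

Definition nbrs (F : {fset cell}) (p : cell) : nat :=
  \sum_(u <- dirs) ((p + u)%R \in F).

Lemma nbrs_opp F p : nbrs F p = \sum_(u <- dirs) ((p - u)%R \in F).
Proof.
rewrite /nbrs.
have {1}-> : dirs = [seq (- u)%R | u <- [:: (-1, 0); (1, 0); (0, -1); (0, 1)]%R] by [].
rewrite big_map.
by rewrite !big_cons !big_nil !addn0 addnCA; congr (_ + (_ + _)); rewrite addnC.
Qed.

Lemma exitsE F u p : (p \in exits F u) = (p \in F) && ((p + u)%R \notin F).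
Proof. by rewrite !inE. Qed.

(** Only two cells matter: [x] becomes an exit unless [x + u] is in [Y], and [x - u] stops being one
    if it lies in [Y]. *)
Lemma card_exitsU1 (x u : cell) (Y : {fset cell}) : u \in dirs -> x \notin Y ->
  #|` exits (x |` Y) u| + (((x + u)%R \in Y) + ((x - u)%R \in Y)) = #|` exits Y u|.+1.
Proof.
move=> uD xY; have u0 := dirs_neq0 uD.
have xu : (x + u == x)%R = false.
  by apply: contraNF u0 => /eqP/(canRL (addKr x)); rewrite addNr => ->.
have -> : exits (x |` Y) u =
    (if (x + u)%R \in Y then fset0 else [fset x]) `|` (exits Y u `\ (x - u)%R).
  apply/fsetP => p; rewrite !(exitsE, inE) negb_or.
  have [->|px] := eqVneq p x.
    by rewrite xu (negbTE xY) andbF orbF /=; case: ifP; rewrite ?inE ?eqxx.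
  rewrite /= -(subr_eq) opprK.
  have -> : (p \in (if (x + u)%R \in Y then fset0 else [fset x])) = false.
    by case: ifP; rewrite !inE // (negbTE px).
  by case: (p \in Y); rewrite /= ?andbF.
rewrite cardfsU.
have -> : (if (x + u)%R \in Y then fset0 else [fset x]) `&` (exits Y u `\ (x - u)%R) = fset0.
  apply/fsetP => p; rewrite !(exitsE, inE).
  by case: ifP; rewrite !inE //; case: eqVneq => // ->; rewrite (negbTE xY) andbF.
rewrite cardfs0 subn0 (cardfsD1 (x - u)%R (exits Y u)) exitsE subrK xY andbT.
move: #|` exits Y u `\ _| => n.
by case: ifP => _; case: (_ \in Y); rewrite ?cardfs0 ?cardfs1 /=; lia.
Qed.

Lemma per_U1 (x : cell) (Y : {fset cell}) : x \notin Y ->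
  per (x |` Y) + (nbrs Y x).*2 = per Y + 4.
Proof.
move=> xY; rewrite -addnn {2}nbrs_opp /per /nbrs -!big_split /=.
have -> : 4 = \sum_(u <- dirs) 1 by rewrite sum1_size.
rewrite -big_split /=; apply: eq_big_seq => u uD.
by rewrite card_exitsU1 // addn1.
Qed.

Lemma card_fset_sum (F : {fset cell}) (P : pred cell) :
  #|` [fset p in F | P p]| = \sum_(p <- F) P p.
Proof.
rewrite card_fset_sum1 big_fset /= big_mkcond /=.
by apply: eq_bigr => p _; case: (P p).
Qed.

Lemma per_nbrs (Y : {fset cell}) : per Y + \sum_(p <- Y) nbrs Y p = 4 * #|` Y|.
Proof.
rewrite /per /nbrs exchange_big /= -big_split /=.
under eq_bigr do rewrite card_fset_sum -big_split /=.
rewrite (eq_bigr (fun _ => #|` Y|)); last first.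
  by move=> u _; rewrite card_fset_sum1; apply: eq_bigr => p _; case: (_ \in Y).
by rewrite big_const_seq /= addn0; lia.
Qed.

(* Connectivity as a statement on locally constant colourings, which avoids manipulating paths. *)
Definition connected (A : {fset cell}) : Prop :=
  forall f : cell -> bool,
    (forall p u, p \in A -> u \in dirs -> (p + u)%R \in A -> f (p + u)%R = f p) ->
  forall p q, p \in A -> q \in A -> f q = f p.

Lemma polyomino_connected (A : {fset cell}) : polyomino A -> connected A.
Proof. by case=> _ cA f fA p q pA qA; apply: (conn_colour fA); apply: cA. Qed.

(** Growing [Y] to [A] by tiles that touch what is already there, each new tile adds at most 4 - 2 =
    2 to the perimeter, by [per_U1]. *)
Lemma per_growth (A Y : {fset cell}) : connected A -> Y `<=` A -> Y != fset0 ->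
  per A + 2 * #|` Y| <= per Y + 2 * #|` A|.
Proof.
move=> cA; elim: {Y}_.+1 {-2}Y (ltnSn (#|` A| - #|` Y|)) => // n IHn Y leYn YA Y0.
have [->//|nYA] := eqVneq Y A.
have ltYA : #|` Y| < #|` A| by apply: fproper_ltn_card; rewrite fproperEneq nYA.
have [x xA /andP[xY nx]] : exists2 x, x \in A & (x \notin Y) && (0 < nbrs Y x).
  apply: contrapT => noX.
  case/fset0Pn: Y0 => y yY; have yA := fsubsetP YA _ yY.
  have /fsubsetPn[x xA xY] : ~~ (A `<=` Y).
    by apply: contra nYA => AY; rewrite eqEfsubset YA.
  (* If no tile of [A] outside [Y] touched [Y], membership in [Y] would be a locally constant
     colouring of [A]. *)
  suff: (x \in Y) = (y \in Y) by rewrite yY (negbTE xY).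
  apply: (cA (fun c => c \in Y)) => // p u pA uD puA.
  have key z v : z \in A -> v \in dirs -> (z + v)%R \in Y -> z \in Y.
    move=> zA vD zvY; apply/negPn/negP => zY; apply: noX; exists z => //.
    by rewrite zY /nbrs (big_rem v) //= zvY.
  apply/idP/idP => [/(key _ _ pA uD)//|pY].
  by apply: (key _ (- u)%R puA); rewrite ?addrK ?dirs_opp.
have cx : #|` x |` Y| = #|` Y|.+1 by rewrite cardfsU1 xY.
have xYA : x |` Y `<=` A by rewrite fsubUset fsub1set xA.
have xY0 : x |` Y != fset0 by apply/fset0Pn; exists x; rewrite !inE eqxx.
have lxY : #|` A| - #|` x |` Y| < n by rewrite cx; lia.
have := IHn _ lxY xYA xY0; have := per_U1 xY; rewrite cx; lia.
Qed.

(** * Forests of tiles *)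

(** Acyclicity of the adjacency graph, stated as a leaf in every nonempty subset to suit induction
    by removing leaves. *)
Definition forest (A : {fset cell}) : Prop :=
  forall Y : {fset cell}, Y `<=` A -> Y != fset0 -> exists2 x, x \in Y & nbrs Y x <= 1.

Lemma per_le (A : {fset cell}) : A != fset0 -> connected A -> per A <= 2 * #|` A| + 2.
Proof.
case/fset0Pn=> x xA cA.
have xA1 : [fset x] `<=` A by rewrite fsub1set.
have x0 : [fset x] != fset0 by apply/fset0Pn; exists x; rewrite inE.
have := per_growth cA xA1 x0; have := per_nbrs [fset x]; rewrite cardfs1; lia.
Qed.

Lemma connected_forest (A : {fset cell}) :
  connected A -> per A = 2 * #|` A| + 2 -> forest A.
Proof.
move=> cA pA Y YA Y0; apply: contrapT => noY.
have := per_growth cA YA Y0; have := per_nbrs Y; rewrite pA.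
suff : #|` Y| * 2 <= \sum_(p <- Y) nbrs Y p by lia.
rewrite card_fset_sum1 big_distrl /= big_seq [leqRHS]big_seq; apply: leq_sum => p pY.
by rewrite mul1n ltnNge; apply/negP => np; apply: noY; exists p.
Qed.

Definition king (p q : cell) : bool :=
  (absz (q.1 - p.1)%R <= 1) && (absz (q.2 - p.2)%R <= 1).

Lemma kingD (x p q : cell) : king (x + p)%R (x + q)%R = king p q.
Proof. by rewrite /king /=; lia. Qed.

Lemma king_sym (p q : cell) : king p q = king q p.
Proof. by rewrite /king; lia. Qed.

Lemma cell_mulrn (u : cell) (i : nat) : (u *+ i)%R = (u.1 *+ i, u.2 *+ i)%R.
Proof. by elim: i => [|i IHi]; rewrite ?mulr0n // !mulrS IHi. Qed.

Definition king_constant (A : {fset cell}) (f : cell -> bool) : Prop :=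
  forall p q, p \notin A -> q \notin A -> king p q -> f p = f q.

(* Three sides of [x] are free: they form a king path, and every free cell
   around [x] touches it. *)
Lemma king_constant_leaf (A : {fset cell}) (f : cell -> bool) (x : cell) :
  king_constant A f -> x \in A -> nbrs A x <= 1 ->
  exists b, forall q, q \notin A -> king x q -> f q = b.
Proof.
move=> fA xA nx; pose g d := f (x + d)%R.
have gA d d' : (x + d)%R \notin A -> (x + d')%R \notin A -> king d d' -> g d = g d'.
  by move=> dA dA' dd'; apply: fA => //; rewrite kingD.
suff [b gb] : exists b, forall d, (x + d)%R \notin A -> king 0%R d -> g d = b.
  exists b => q qA xq; have := gb (q - x)%R; rewrite /g addrC subrK; apply=> //.
  by rewrite -(kingD x) addr0 addrC subrK.
have kd (d : cell) : (x + d)%R \notin A -> king 0%R d ->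
   d \in [:: (1,0); (1,1); (0,1); (-1,1); (-1,0); (-1,-1); (0,-1); (1,-1)]%R.
  case: d => a b dA; have : (a, b) != 0%R by apply: contraNneq dA => ->; rewrite addr0.
  rewrite /king /= !subr0 !inE !xpair_eqE; lia.
(* Here [m] is the middle one of three free sides; [s] and [s'] are the other two, opposite to each
   other. *)
have mid m s s' : (x + m)%R \notin A -> (x + s)%R \notin A -> (x + s')%R \notin A ->
    king m s -> king m s' ->
    all (fun d => king d s || king d s')
      [:: (1,0); (1,1); (0,1); (-1,1); (-1,0); (-1,-1); (0,-1); (1,-1)]%R ->
    exists b, forall d, (x + d)%R \notin A -> king 0%R d -> g d = b.
  move=> mA sA sA' ms ms' /allP near; exists (g m) => d dA /(kd d dA)/near/orP[] ds.
    by rewrite (gA d s) // (gA m s).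
  by rewrite (gA d s') // (gA m s').
move: nx; rewrite /nbrs /dirs !big_cons big_nil addn0.
case: (boolP (_ \in A)) => E; case: (boolP (_ \in A)) => W;
case: (boolP (_ \in A)) => N; case: (boolP (_ \in A)) => S //= _;
by [apply: (mid _ _ _ E N S) | apply: (mid _ _ _ W N S)
   | apply: (mid _ _ _ N E W) | apply: (mid _ _ _ S E W)].
Qed.

(** Induction on the number of tiles: a leaf is freed and given the common colour of the free cells
    around it, which keeps the colouring constant under king moves. With no tiles left, unit steps
    reach the whole plane. *)
Lemma forest_king_constant (A : {fset cell}) (f : cell -> bool) :
  forest A -> king_constant A f -> forall p q, p \notin A -> q \notin A -> f p = f q.
Proof.
elim: {A}_.+1 {-2}A (ltnSn #|` A|) f => // n IHn A leA f foA fA p q pA qA.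
have [A0|A0] := eqVneq A fset0.
  subst A; have f1 a b : f (a, b) = f (0, b)%R.
    have stp (c : int) : f (c + 1, b)%R = f (c, b).
      by apply: fA; rewrite ?inE // /king /=; lia.
    elim/int_rec: a => [//|m IHm|m IHm].
      by rewrite -addn1 PoszD stp.
    by rewrite -IHm -addn1 PoszD opprD -(stp (- _ - _)%R) subrK.
  have f2 (b : int) : f (0, b)%R = f (0, 0)%R.
    have stp (c : int) : f (0, c + 1)%R = f (0, c)%R.
      by apply: fA; rewrite ?inE // /king /=; lia.
    elim/int_rec: b => [//|m IHm|m IHm].
      by rewrite -addn1 PoszD stp.
    by rewrite -IHm -addn1 PoszD opprD -(stp (- _ - _)%R) subrK.
  by case: p q {pA qA} => [a b] [c d]; rewrite f1 f2 [RHS]f1 f2.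
have [x xA nx] := foA A (fsubset_refl A) A0.
have [b fb] := king_constant_leaf fA xA nx.
pose g c := if c == x then b else f c.
have notA r : r != x -> r \notin A `\ x -> r \notin A by rewrite !inE => ->.
suff : g p = g q.
  by rewrite /g; case: eqP pA => [->|_ _]; rewrite ?xA //; case: eqP qA => [->|_ _]; rewrite ?xA.
apply: (IHn (A `\ x)); rewrite ?inE ?(negbTE pA) ?(negbTE qA) ?andbF //.
- by move: leA; rewrite (cardfsD1 x A) xA.
- by move=> Y YA; apply: foA; apply: fsubset_trans YA (fsubD1set _ _).
move=> r s rA sA rs; rewrite /g.
case: eqP => [rx|/eqP/notA/(_ rA) rA']; case: eqP => [sx|/eqP/notA/(_ sA) sA'] //.
- by rewrite -(fb s) // -rx.
- by rewrite (fb r) // -sx king_sym.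
exact: fA.
Qed.

(** * Rays leaving a finite set, and labels counted at their exits *)

Lemma walk (F : {fset cell}) (p u : cell) : u \in dirs -> p \in F ->
  exists n, (forall i, i <= n -> (p + u *+ i)%R \in F) /\ (p + u *+ n.+1)%R \notin F.
Proof.
move=> uD pF.
have inj : injective (fun i => (p + u *+ i)%R).
  move=> i j /addrI; move: uD; rewrite !inE => /or4P[] /eqP->;
  by rewrite !cell_mulrn /= => -[]; lia.
have ex : exists n, (p + u *+ n)%R \notin F.
  apply: contrapT => noN.
  have sub : {subset [seq (p + u *+ i)%R | i <- iota 0 #|` F|.+1] <= F}.
    move=> c /mapP[i _ ->]; apply/negPn/negP => ci; apply: noN; by exists i.
  have := uniq_leq_size _ sub; rewrite map_inj_uniq // iota_uniq size_map size_iota.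
  by move=> /(_ isT); rewrite ltnn.
case: (ex_minnP ex) => -[|n] nF nmin; first by rewrite mulr0n addr0 pF in nF.
exists n; split=> // i lein; apply/negPn/negP => /nmin; lia.
Qed.

Section Key.
Variables (K : choiceType) (F : {fset cell}) (u : cell) (k : cell -> K).
Hypotheses (uD : u \in dirs) (ku : forall p, p \in F -> (p + u)%R \in F -> k (p + u)%R = k p).

Lemma walk_key (p : cell) : p \in F ->
  exists n, [/\ forall i, i <= n -> (p + u *+ i)%R \in F,
    (p + u *+ n)%R \in exits F u & k (p + u *+ n)%R = k p].
Proof.
move=> pF; have [n [inF notF]] := walk uD pF; exists n; split=> //.
  by rewrite exitsE inF // -addrA -mulrSr notF.
have : forall i, i <= n -> k (p + u *+ i)%R = k p.
  elim=> [|i IHi] lein; first by rewrite mulr0n addr0.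
  by rewrite mulrSr addrA ku -?IHi ?inF // 1?ltnW // -addrA -mulrSr inF.
by apply.
Qed.

(** Walking in direction [u] until [F] ends keeps the label, so every label occurs at an exit. Lower
    bounds on perimeters come from this. *)
Lemma key_exits : k @` F = k @` (exits F u).
Proof.
apply/fsetP => c; apply/imfsetP/imfsetP => /= -[p pF ->]; last first.
  by exists p => //; move: pF; rewrite exitsE => /andP[].
by have [n [_ nF <-]] := walk_key pF; exists (p + u *+ n)%R.
Qed.

Lemma leq_key_exits : #|` k @` F| <= #|` exits F u|.
Proof. by rewrite key_exits leq_imfset_card. Qed.

(** The equality case: one exit per label. It later forces holes to be single cells and rows and
    columns to be intervals. *)
Lemma key_exits_inj : #|` exits F u| <= #|` k @` F| ->
  forall p q, p \in exits F u -> q \in exits F u -> k p = k q -> p = q.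
Proof.
rewrite key_exits => le p q pF qF; apply: (elimT (card_in_imfsetP k (exits F u))) => //.
by rewrite eqn_leq leq_imfset_card.
Qed.
End Key.

(** * Holes and projections *)

Lemma enclosed_step (A : {fset cell}) (c u : cell) :
  enclosed A c -> u \in dirs -> (c + u)%R \notin A -> enclosed A (c + u)%R.
Proof.
case=> cA [N cN] uD cuA; split=> //; exists N => d cd; apply: cN.
by apply: conn_trans cd; apply: conn_step.
Qed.

(** Finitely many representatives, each with a bounded component, put all enclosed cells in one box
    of radius [N]. *)
Lemma enclosed_fset (A : {fset cell}) (h : nat) : num_holes A h ->
  exists H : {fset cell}, forall c, c \in H <-> enclosed A c.
Proof.
case=> reps [_ encl _ cover].
have [N bN] : exists N, forall r d, r \in reps -> conn (compl A) r d ->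
    absz d.1 <= N /\ absz d.2 <= N.
  elim: reps encl {cover} => [|r s IHs] encl; first by exists 0.
  have [|N sN] := IHs; first by move=> q qs; apply: encl; rewrite inE qs orbT.
  have [_ [N' rN]] := encl r (mem_head _ _).
  exists (maxn N N') => q d; rewrite inE => /orP[/eqP->|qs].
    by move=> /rN; lia.
  by move=> /(sN _ _ qs); lia.
have [X XP] : exists X : {fset int}, forall x : int, absz x <= N -> x \in X.
  exists (seq_fset tt [seq (i%:Z - N%:Z)%R | i <- iota 0 (2 * N).+1]) => x xN.
  rewrite seq_fsetE; apply/mapP; exists (absz (x + N%:Z)%R); last by lia.
  by rewrite mem_iota; lia.
exists [fset c in X `*` X | `[< enclosed A c >]] => c.
rewrite !inE /=; split=> [/andP[_ /asboolP]//|ec]; apply/andP; split; last exact/asboolP.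
have [r rr rc] := cover c ec; have [c1 c2] := bN r c rr rc.
by rewrite !XP.
Qed.

(** Four lower bounds, one per direction, are summed; if the sum is attained, each of them is. *)
Lemma per_ge (F : {fset cell}) (a b : nat) (w := fun u : cell => if u.1 == 0%R then a else b) :
  (forall u, u \in dirs -> w u <= #|` exits F u|) ->
  2 * (a + b) <= per F /\
  (per F <= 2 * (a + b) -> forall u, u \in dirs -> #|` exits F u| <= w u).
Proof.
move=> /allP/and5P[l1 l2 l3 l4 _].
rewrite /per /dirs !big_cons big_nil; move: l1 l2 l3 l4; rewrite /w /= => l1 l2 l3 l4.
split=> [|ge u]; first by lia.
by rewrite !inE => /or4P[] /eqP-> /=; lia.
Qed.

Section Holes.
Variables (A H : {fset cell}) (h : nat).
Hypothesis HP : forall c, c \in H <-> enclosed A c.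

Lemma hole_notin c : c \in H -> c \notin A.
Proof. by case/HP. Qed.

Lemma hole_nbr c u : c \in H -> u \in dirs -> (c + u)%R \in A `|` H.
Proof.
move=> /HP cH uD; rewrite inE; have [//|cuA] := boolP ((c + u)%R \in A).
by apply/HP; apply: enclosed_step.
Qed.

(** A free neighbour of an enclosed cell is enclosed, so edges of [H] border tiles of [A]. They and
    the edges of the filled set are distinct edges of [A]. *)
Lemma per_holes : per (A `|` H) + per H <= per A.
Proof.
have -> : per H = \sum_(u <- dirs) #|` exits H (- u)%R|.
  by rewrite /per /dirs !big_cons !big_nil addnCA; congr (_ + (_ + _)); rewrite addnCA.
rewrite /per -big_split /= big_seq [leqRHS]big_seq; apply: leq_sum => u uD.
(* An edge of [H] facing [- u] is the edge facing [u] of the tile on its other side. *)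
have <- : #|` [fset (c - u)%R | c in exits H (- u)%R]| = #|` exits H (- u)%R|.
  by rewrite card_imfset //=; apply: addIr.
rewrite -cardfsUI.
have -> : exits (A `|` H) u `&` [fset (c - u)%R | c in exits H (- u)%R] = fset0.
  apply/fsetP => c; rewrite !inE; apply/negP => /andP[/andP[_ /norP[_ +]] /imfsetP[/= d + cd]].
  by rewrite exitsE cd subrK => /negbTE->.
rewrite cardfs0 addn0; apply: fsubset_leq_card; apply/fsubsetP => c.
rewrite !inE => /orP[/andP[/orP[cA|cH] /norP[cuA cuH]]|/imfsetP[/= d + ->]].
- by rewrite cA cuA.
- by have := hole_nbr cH uD; rewrite inE (negbTE cuA) (negbTE cuH).
rewrite exitsE subrK => /andP[dH duH]; rewrite hole_notin // andbT.
by have := hole_nbr dH (dirs_opp uD); rewrite inE (negbTE duH) orbF.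
Qed.

Hypothesis nh : num_holes A h.

(** The label is the index of the first representative connected to the cell; as representatives are
    pairwise unconnected, every index below [h] occurs. *)
Lemma hole_key : exists k : cell -> nat,
  (forall c u, c \in H -> u \in dirs -> (c + u)%R \in H -> k (c + u)%R = k c) /\
  h <= #|` k @` H|.
Proof.
case: nh => reps [sz encl dist cover].
exists (fun c => find (fun r => `[< conn (compl A) r c >]) reps); split=> [c u cH uD cuH|].
  apply: eq_find => r; apply: asbool_equiv_eq.
  have ccu : conn (compl A) c (c + u)%R by apply: conn_step => //; apply: hole_notin.
  by split=> rc; apply: conn_trans rc _ => //; apply: conn_sym.
rewrite -[h](size_iota 0) cardfE -?cardE.
have sub : {subset iota 0 h <= (fun c => find (fun r => `[< conn (compl A) r c >]) reps) @` H}.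
  move=> i; rewrite mem_iota /= add0n => lih.
  have rr : nth (0%R, 0%R) reps i \in reps by rewrite mem_nth ?sz.
  apply/imfsetP; exists (nth (0%R, 0%R) reps i); first by apply/HP; apply: encl.
  have cii : conn (compl A) (nth (0%R, 0%R) reps i) (nth (0%R, 0%R) reps i).
    by apply: conn_refl; case: (encl _ rr).
  have hs : has (fun r => `[< conn (compl A) r (nth (0%R, 0%R) reps i) >]) reps.
    by apply/hasP; exists (nth (0%R, 0%R) reps i) => //; apply/asboolP.
  have /asboolP := nth_find (0%R, 0%R) hs.
  move: hs; rewrite has_find sz; set j := find _ _ => ljh cji.
  by apply/eqP/negPn/negP => /eqP ij; apply: (dist j i) => // ji; apply: ij.
have := uniq_leq_size (iota_uniq 0 h) sub.
by rewrite -cardfE.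
Qed.

Lemma holes_lower : 4 * h <= per H /\ h <= #|` H|.
Proof.
have [k [kH kh]] := hole_key; split; last by apply: leq_trans kh _; rewrite leq_imfset_card.
have [|le _] := @per_ge H h h; last by lia.
by move=> u uD; rewrite if_same; apply: leq_trans kh (leq_key_exits uD _) => p pH; apply: kH.
Qed.

(** Equality leaves one exit per hole and direction. Two adjacent cells of a hole would give two
    exits in a perpendicular direction, on parallel rays. *)
Lemma holes_unit : per H <= 4 * h ->
  (forall c u, c \in H -> u \in dirs -> (c + u)%R \notin H) /\ #|` H| = h.
Proof.
move=> pH; have [k [kH kh]] := hole_key.
have [|_ ge'] := @per_ge H h h.
  by move=> u uD; rewrite if_same; apply: leq_trans kh (leq_key_exits uD _) => p pH'; apply: kH.
have ge u : u \in dirs -> #|` exits H u| <= h by move=> /ge'; rewrite if_same; apply; lia.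
have iso c u : c \in H -> u \in dirs -> (c + u)%R \notin H.
  move=> cH uD; apply/negP => cuH.
  have : (u.2, u.1) \in dirs by move: uD; rewrite !inE => /or4P[] /eqP->.
  set v := (u.2, u.1) => vD.
  have kv p : p \in H -> (p + v)%R \in H -> k (p + v)%R = k p by move=> ? ?; apply: kH.
  have [n [_ nX nk]] := walk_key vD kv cH.
  have [m [_ mX mk]] := walk_key vD kv cuH.
  have le_k : #|` exits H v| <= #|` k @` H| by apply: leq_trans (ge v vD) kh.
  have := key_exits_inj vD kv le_k nX mX; rewrite nk mk kH // => /(_ erefl).
  rewrite !cell_mulrn -addrA => /addrI; rewrite /v.
  by move: uD; rewrite !inE => /or4P[] /eqP-> [] /=; lia.
split=> //; have [_ hH] := holes_lower.
have : exits H (1, 0)%R = H.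
  apply/fsetP => c; rewrite exitsE; case: (boolP (c \in H)) => //= cH; exact: iso.
by have := ge (1, 0)%R isT => + eH; rewrite eH; lia.
Qed.
End Holes.

(** The label of a cell is its line along [u]: each occupied line has an exit at either end. In the
    equality case there are no others, so [F] meets every line in an interval. *)
Lemma per_proj (F : {fset cell}) (xs := [fset c.1 | c in F]) (ys := [fset c.2 | c in F]) :
  2 * (#|` xs| + #|` ys|) <= per F /\
  (per F <= 2 * (#|` xs| + #|` ys|) -> forall p u m k, u \in dirs -> k <= m ->
     p \in F -> (p + u *+ m)%R \in F -> (p + u *+ k)%R \in F).
Proof.
pose key (u c : cell) := if u.1 == 0%R then c.1 else c.2.
have keyu u p : u \in dirs -> key u (p + u)%R = key u p.
  by rewrite !inE => /or4P[] /eqP->; rewrite /key /= addr0.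
have le u : u \in dirs -> #|` key u @` F| <= #|` exits F u|.
  by move=> uD; apply: leq_key_exits => // p _ _; apply: keyu.
have keyE u : u \in dirs -> #|` key u @` F| = if u.1 == 0%R then #|` xs| else #|` ys|.
  by rewrite !inE => /or4P[] /eqP->.
have [|le1 ge1] := @per_ge F #|` xs| #|` ys|; first by move=> u uD; rewrite -keyE ?le.
split=> // ple p u m k uD lekm pF pmF.
have ge : #|` exits F u| <= #|` key u @` F|.
  by rewrite keyE // ge1.
have ku q : q \in F -> (q + u)%R \in F -> key u (q + u)%R = key u q by move=> _ _; apply: keyu.
have [n [nF nX nk]] := walk_key uD ku pF.
have [n' [_ nX' nk']] := walk_key uD ku pmF.
have kpm : key u (p + u *+ m)%R = key u p.
  by elim: m {lekm pmF nX' nk'} => [|m IHm]; rewrite ?mulr0n ?addr0 // mulrSr addrA keyu.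
have := key_exits_inj uD ku ge nX nX'; rewrite nk nk' kpm => /(_ erefl).
rewrite -addrA -mulrnDr => /addrI nmn; apply: nF; move: uD nmn; rewrite !cell_mulrn.
by rewrite !inE => /or4P[] /eqP-> [] /=; lia.
Qed.

(** * Extremal polyominoes *)

(* With [S = w + v], AM-GM and the hypotheses force [(S - 2) ^ 2 > (2M - 1) ^ 2]. *)
Lemma box_bound (M w v t h n : nat) : 2 <= M -> 3 * h + 1 = M ^ 2 ->
  n + h <= t -> t <= w * v -> n + h <= M ^ 2 + 2 * M -> w + v + 2 * h <= n + 1 ->
  n + h = M ^ 2 + 2 * M /\ w + v = 2 * M + 2.
Proof.
move=> M2 hM nt twv nM wvn; set S := w + v in wvn *.
have amgm : 4 * (w * v) <= S ^ 2 by rewrite /S !expnS expn0; case: (leqP w v) => ?; nia.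
have S2 : (2 * M - 1) ^ 2 < (S - 2) ^ 2 by move: hM nM; rewrite !expnS !expn0 in amgm *; nia.
have : 2 * M - 1 < S - 2 by rewrite -(ltn_exp2r _ _ (isT : 0 < 2)).
lia.
Qed.

(** As [z - e] is missing, [z] is an end of the interval [X], and its size fixes the rest. The
    position is given by the distance to [z], which avoids an existential. *)
Lemma int_interval (X : {fset int}) (z e : int) (M : nat) : (e = 1 \/ e = -1)%R ->
  (forall x y w, x \in X -> w \in X -> (x <= y <= w)%R -> y \in X) ->
  z \in X -> (z - e)%R \notin X -> #|` X| = M.+1 ->
  forall x, (x \in X) = (x == z + e * (absz (x - z)%R)%:Z)%R && (absz (x - z)%R <= M).
Proof.
move=> e1 cX zX zeX cardX.
have inX i : (z + e * i%:Z)%R \in X -> forall j, j <= i -> (z + e * j%:Z)%R \in X.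
  move=> iX j ji; case: e1 zeX iX => ->; rewrite ?mul1r ?mulN1r => _ iX.
    by apply: cX zX iX _; lia.
  by apply: cX iX zX _; lia.
have inj : injective (fun i : nat => (z + e * i%:Z)%R) by move=> i j; case: e1 => ->; lia.
have iM i : ((z + e * i%:Z)%R \in X) = (i <= M).
  apply/idP/idP => [iX|leiM].
    have sub : {subset [seq (z + e * j%:Z)%R | j <- iota 0 i.+1] <= X}.
      by move=> c /mapP[j]; rewrite mem_iota => ji ->; apply: (inX i) => //; lia.
    have := uniq_leq_size _ sub; rewrite map_inj_uniq // iota_uniq size_map size_iota.
    by move=> /(_ isT) le; have := leq_trans le (eq_leq cardX).
  apply/negPn/negP => iX.
  have sub : {subset X <= [seq (z + e * j%:Z)%R | j <- iota 0 i]}.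
    move=> x xX; apply/mapP; exists (absz (x - z)%R).
      rewrite mem_iota /= add0n ltnNge; apply: contra iX => ix; apply: (inX (absz (x - z)%R)) => //.
      suff <- : x = (z + e * (absz (x - z)%R)%:Z)%R by [].
      apply/eqP/negPn/negP => xz; case/negP: zeX.
      case: e1 xz => -> xz; [apply: (cX x _ z)|apply: (cX z _ x)] => //; move/eqP: xz; lia.
    apply/eqP/negPn/negP => xz; case/negP: zeX.
    case: e1 xz => -> xz; [apply: (cX x _ z)|apply: (cX z _ x)] => //; move/eqP: xz; lia.
  have le := uniq_leq_size (fset_uniq X) sub; rewrite size_map size_iota in le.
  by have := leq_trans (eq_leq (esym cardX)) le; lia.
move=> x; rewrite -iM; case: eqP => [<-//|xz] /=; apply/negP => xX; case/negP: zeX.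
case: e1 xz => -> xz; [apply: (cX x _ z)|apply: (cX z _ x)] => //; lia.
Qed.

Lemma cell_ext (p q : cell) : p.1 = q.1 -> p.2 = q.2 -> p = q.
Proof. by case: p q => [a b] [c d] /= -> ->. Qed.

Lemma card_fsetM (X Y : {fset int}) : #|` X `*` Y| = #|` X| * #|` Y|.
Proof.
rewrite /fsetM (perm_size (enum_imfset2 _ _)) ?size_allpairs_dep //=; last first.
  by move=> [x y] [x' y'] _ _ /= [-> ->].
have aux (s : seq int) n : sumn [seq n | _ <- s] = size s * n by elim: s => //= _ s ->.
exact: aux.
Qed.

Lemma fsub_proj (F : {fset cell}) : F `<=` [fset c.1 | c in F] `*` [fset c.2 | c in F].
Proof.
by apply/fsubsetP => c cF; rewrite in_fsetM; apply/andP; split; apply/imfsetP; exists c.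
Qed.

Section Extremal.
Variables (A : {fset cell}) (M h : nat).
Hypotheses (M2 : 2 <= M) (hM : 3 * h + 1 = M ^ 2).
Hypotheses (pA : polyomino A) (nA : num_holes A h) (cardA : #|` A| + h <= M ^ 2 + 2 * M).

(** With [w] and [v] the sides of the bounding box, 2(w + v) + 4h is at most [per A], hence at most
    2|A| + 2. Then [box_bound] turns every estimate into an equality, and the equality cases above
    apply. *)
Lemma extremal_eq : exists H : {fset cell},
  [/\ [/\ forall c, c \in H -> c \notin A,
      forall c u, c \in H -> u \in dirs -> (c + u)%R \in A & H != fset0],
      forest A, #|` A| + h = M ^ 2 + 2 * M,
      #|` A `|` H| = M ^ 2 + 2 * M &
      let F := A `|` H in
      #|` [fset c.1 | c in F]| + #|` [fset c.2 | c in F]| = 2 * M + 2 /\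
      per F <= 2 * (#|` [fset c.1 | c in F]| + #|` [fset c.2 | c in F]|)].
Proof.
have [H HP] := enclosed_fset nA; exists H.
have cA := polyomino_connected pA; have A0 : A != fset0 by case: pA.
have pleA := per_le A0 cA; have psplit := per_holes HP.
have [pH cH] := holes_lower HP nA.
have [pF _] := per_proj (A `|` H).
set F := A `|` H in psplit pF *; set xs := [fset c.1 | c in F] in pF *.
set ys := [fset c.2 | c in F] in pF *.
have cF : #|` F| = #|` A| + #|` H|.
  rewrite -cardfsUI (_ : A `&` H = fset0) ?cardfs0 ?addn0 //.
  by apply/fsetP => c; rewrite !inE; apply/negP => /andP[cA' /(hole_notin HP)]; rewrite cA'.
have Fxy : #|` F| <= #|` xs| * #|` ys|.
  by rewrite -card_fsetM fsubset_leq_card // fsub_proj.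
have [||e1 e2] := @box_bound M #|` xs| #|` ys| #|` F| h #|` A| M2 hM _ Fxy cardA; [lia|lia|].
have pH4 : per H <= 4 * h by lia.
have [uH cHh] := holes_unit HP nA pH4.
split=> //; [split|apply: connected_forest => //; lia|lia|split=> //; rewrite -/xs -/ys e2; lia].
- exact: hole_notin.
- by move=> c u cH' uD; have := hole_nbr HP cH' uD; rewrite inE (negbTE (uH _ _ cH' uD)) orbF.
by rewrite -cardfs_gt0 cHh; move: hM; rewrite !expnS expn0; nia.
Qed.

(** The sides of the box sum to 2M + 2 and its area is at least (M + 1)^2 - 1, so it is either a
    square lacking one cell or a full rectangle with sides M and M + 2. *)
Lemma extremal_corner : exists (H : {fset cell}) (z : cell) (e : int * int),
  [/\ [/\ forall c, c \in H -> c \notin A,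
      forall c u, c \in H -> u \in dirs -> (c + u)%R \in A & forest A],
      #|` A| + h = M ^ 2 + 2 * M, (e.1 = 1 \/ e.1 = -1)%R, (e.2 = 1 \/ e.2 = -1)%R &
      forall c, (c \in A `|` H) =
        [&& c != z, (c.1 == z.1 + e.1 * (absz (c.1 - z.1)%R)%:Z)%R, absz (c.1 - z.1)%R <= M,
            (c.2 == z.2 + e.2 * (absz (c.2 - z.2)%R)%:Z)%R & absz (c.2 - z.2)%R <= M]].
Proof.
have [H [[HA HAu H0] fA cA cF [exy pF]]] := extremal_eq; exists H.
have [_ /(_ pF) conv] := per_proj (A `|` H); move: exy {pF}.
have := fsub_proj (A `|` H).
set F := A `|` H in cF conv *; set xs := [fset c.1 | c in F]; set ys := [fset c.2 | c in F].
move=> Fxy exy.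
have xsP c : c \in F -> c.1 \in xs by move=> cF'; apply/imfsetP; exists c.
have ysP c : c \in F -> c.2 \in ys by move=> cF'; apply/imfsetP; exists c.
have cFxy := card_fsetM xs ys.
have rowc a b c d : (a, d) \in F -> (c, d) \in F -> (a <= b <= c)%R -> (b, d) \in F.
  move=> aF cF' /andP[ab bc].
  have pt x : (a <= x)%R -> ((a, d) + (1, 0) *+ absz (x - a))%R = (x, d).
    by move=> ax; apply: cell_ext; rewrite cell_mulrn /= ?mul0rn ?addr0 ?natz; lia.
  have := conv (a, d) (1, 0)%R (absz (c - a)%R) (absz (b - a)%R) isT _ aF.
  by rewrite !pt //; [apply=> //; lia | lia].
have colc a b c d : (d, a) \in F -> (d, c) \in F -> (a <= b <= c)%R -> (d, b) \in F.
  move=> aF cF' /andP[ab bc].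
  have pt x : (a <= x)%R -> ((d, a) + (0, 1) *+ absz (x - a))%R = (d, x).
    by move=> ax; apply: cell_ext; rewrite cell_mulrn /= ?mul0rn ?addr0 ?natz; lia.
  have := conv (d, a) (0, 1)%R (absz (c - a)%R) (absz (b - a)%R) isT _ aF.
  by rewrite !pt //; [apply=> //; lia | lia].
have [xsM|xsM] := eqVneq #|` xs| M.+1; last first.
  have FE : F = xs `*` ys.
    apply/eqP; rewrite eqEfcard Fxy cFxy cF.
    move: (fsubset_leq_card Fxy); rewrite cFxy cF => lt.
    have : (#|` xs| == M) || (#|` xs| == M.+2) by move: lt exy xsM; rewrite !expnS expn0; nia.
    by case/orP=> /eqP eM; move: exy lt; rewrite eM !expnS expn0; nia.
  (* In a full rectangle the king neighbours of a hole stay inside, so no king moves through free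
     cells lead from a hole to the outside, against [forest_king_constant]. *)
  have Hking p q : p \in H -> q \notin A -> king p q -> q \in H.
    move=> pH qA pq; suff : q \in F by rewrite inE (negbTE qA).
    have inF u : u \in dirs -> (p + u)%R \in F by move=> uD; rewrite inE HAu.
    have pF : p \in F by rewrite inE pH orbT.
    have := xsP _ (inF (1, 0)%R isT); have := xsP _ (inF (-1, 0)%R isT); have := xsP _ pF.
    have := ysP _ (inF (0, 1)%R isT); have := ysP _ (inF (0, -1)%R isT); have := ysP _ pF.
    rewrite FE in_fsetM; case: p q pq {pH qA pF inF} => [a b] [c d] /=; rewrite /king /=.
    move=> pq y1 y2 y3 x1 x2 x3; apply/andP; split.
      have : (c = a \/ c = a + -1 \/ c = a + 1)%R by lia.
      by case=> [->|[->|->]].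
    have : (d = b \/ d = b + -1 \/ d = b + 1)%R by lia.
    by case=> [->|[->|->]].
  case/fset0Pn: H0 => p pH.
  have pF : p \in F by rewrite inE pH orbT.
  have [n [_]] := walk (isT : (1, 0)%R \in dirs) pF; rewrite inE negb_or => /andP[nA' nH].
  have := @forest_king_constant A (fun c => c \in H) fA _ p _ (HA _ pH) nA'.
  rewrite pH (negbTE nH) => /(_ _)/wrap[]// q r qA rA qr.
  by apply/idP/idP => ?; [apply: Hking qr|apply: (Hking r) => //; rewrite king_sym].
have ysM : #|` ys| = M.+1 by lia.
have /cardfs1P[z zE] : #|` (xs `*` ys) `\` F| == 1.
  rewrite cardfsDS // cF cFxy xsM ysM; apply/eqP; rewrite !expnS expn0; lia.
have FE c : (c \in F) = [&& c != z, c.1 \in xs & c.2 \in ys].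
  have : (c \in (xs `*` ys) `\` F) = (c == z) by rewrite zE inE.
  rewrite in_fsetD in_fsetM; case: (boolP (c \in F)) => cF' /=.
    by rewrite xsP // ysP // => <-.
  by move=> ->; rewrite andNb.
have /andP[zx zy] : (z.1 \in xs) && (z.2 \in ys).
  have : z \in (xs `*` ys) `\` F by rewrite zE inE.
  by rewrite in_fsetD in_fsetM => /andP[].
have other (X : {fset int}) y : #|` X| = M.+1 -> exists2 y', y' \in X & y' != y.
  move=> XM; have : #|` X `\ y| > 0 by have := cardfsD1 y X; lia.
  by rewrite cardfs_gt0 => /fset0Pn[y']; rewrite !inE => /andP[? ?]; exists y'.
have [x' x'x x'z] := other _ z.1 xsM; have [y' y'y y'z] := other _ z.2 ysM.
(* The row [y'] avoids [z], so it contains all of [xs], and convexity of that row passes to [xs]. *)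
have cx a b c : a \in xs -> c \in xs -> (a <= b <= c)%R -> b \in xs.
  move=> ax cx abc; suff /xsP : (b, y') \in F by [].
  by apply: (rowc a _ c) => //; rewrite FE /= y'y ?ax ?cx !andbT; apply: contraNneq y'z => <-.
have cy a b c : a \in ys -> c \in ys -> (a <= b <= c)%R -> b \in ys.
  move=> ax cx' abc; suff /ysP : (x', b) \in F by [].
  by apply: (colc a _ c) => //; rewrite FE /= x'x ?ax ?cx' !andbT; apply: contraNneq x'z => <-.
(* With columns on both sides of [z], convexity of its row would put [z] in [F]. So [z] is at an
   end, and [e] points inwards. *)
have [ex ex1 exz] : exists2 e : int, (e = 1 \/ e = -1)%R & (z.1 - e)%R \notin xs.
  have [l|l] := boolP ((z.1 - 1)%R \in xs); last by exists 1%R => //; left.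
  exists (-1)%R; first by right.
  apply/negP => r; have : z \in F; last by rewrite FE eqxx.
  case: z {zE} FE l r zx zy x'z y'z => a b /= FE l r zx zy _ _.
  apply: (rowc (a - 1)%R _ (a - -1)%R); last by lia.
    by rewrite FE xpair_eqE /= l zy; lia.
  by rewrite FE xpair_eqE /= r zy; lia.
have [ey ey1 eyz] : exists2 e : int, (e = 1 \/ e = -1)%R & (z.2 - e)%R \notin ys.
  have [l|l] := boolP ((z.2 - 1)%R \in ys); last by exists 1%R => //; left.
  exists (-1)%R; first by right.
  apply/negP => r; have : z \in F; last by rewrite FE eqxx.
  case: z {zE exz} FE l r zx zy x'z y'z => a b /= FE l r zx zy _ _.
  apply: (colc (b - 1)%R _ (b - -1)%R); last by lia.
    by rewrite FE xpair_eqE /= l zx; lia.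
  by rewrite FE xpair_eqE /= r zx; lia.
exists z, (ex, ey); split=> // c; rewrite FE.
by rewrite (int_interval ex1 cx zx exz xsM) (int_interval ey1 cy zy eyz ysM) -!andbA.
Qed.
End Extremal.

(** * Mazes *)

Definition black_const (M : nat) (W f : nat -> nat -> bool) : Prop :=
  (forall i j, i < M -> j <= M -> ~~ W i j -> ~~ W i.+1 j -> f i j = f i.+1 j) /\
  (forall i j, i <= M -> j < M -> ~~ W i j -> ~~ W i j.+1 -> f i j = f i j.+1).

(** White cells of a maze never share a side, so the king moves between them are the diagonal
    ones. *)
Definition white_const (M : nat) (W f : nat -> nat -> bool) : Prop :=
  (forall i j, i < M -> j < M -> W i j -> W i.+1 j.+1 -> f i j = f i.+1 j.+1) /\
  (forall i j, i < M -> j < M -> W i.+1 j -> W i j.+1 -> f i.+1 j = f i j.+1).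

(* [W i j] says that the cell [(i, j)] of the square [0 <= i, j <= M] is white,
   that is, a hole or the missing corner; black cells are tiles. *)
Record maze (M : nat) (W : nat -> nat -> bool) : Prop := Maze {
  maze00 : W 0 0;
  maze_in : forall i j, i <= M -> j <= M -> W i j ->
    (i = 0 /\ j = 0) \/ (0 < i < M /\ 0 < j < M);
  maze_hor : forall i j, i < M -> j <= M -> W i j -> ~~ W i.+1 j;
  maze_ver : forall i j, i <= M -> j < M -> W i j -> ~~ W i j.+1;
  maze_square : forall i j, i < M -> j < M ->
    [|| W i j, W i.+1 j, W i j.+1 | W i.+1 j.+1];
  maze_black : forall f, black_const M W f -> forall i j i' j',
    i <= M -> j <= M -> i' <= M -> j' <= M -> ~~ W i j -> ~~ W i' j' -> f i j = f i' j';
  maze_white : forall f, white_const M W f -> forall i j i' j',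
    i <= M -> j <= M -> i' <= M -> j' <= M -> W i j -> W i' j' -> f i j = f i' j' }.

(* Inside the open square, [pattern k i j] says that [i] and [j] have the same
   2-adic valuation. *)
Fixpoint pattern (k i j : nat) : bool :=
  if k is k'.+1 then if odd i then odd j else ~~ odd j && pattern k' i./2 j./2
  else (i == 0) && (j == 0).

Lemma halves n : exists x, n = x.*2 \/ n = x.*2.+1.
Proof. by exists n./2; rewrite -[n in n = _ \/ _]odd_double_half; lia. Qed.

Lemma maze_tr M W : maze M W -> maze M (fun i j => W j i).
Proof.
case=> w0 win wh wv wq wb ww; split=> //.
- by move=> i j iM jM /win; lia.
- by move=> i j iM jM; apply: wv.
- by move=> i j iM jM; apply: wh.
- by move=> i j iM jM; have := wq j i jM iM; do 4 case: (W _ _).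
- move=> f [f1 f2] i j i' j' iM jM iM' jM' wij wij'.
  by apply: (wb (fun i j => f j i)) => //; split=> *; [apply: f2|apply: f1].
- move=> f [f1 f2] i j i' j' iM jM iM' jM' wij wij'.
  by apply: (ww (fun i j => f j i)) => //; split=> *; [apply: f1|apply/esym/f2].
Qed.

Section Halving.
Variables (m : nat) (W : nat -> nat -> bool).
Hypotheses (m_gt0 : 0 < m) (mW : maze m.*2 W).

(** Diagonal steps preserve the parity of [i + j], which is even at the white corner. *)
Lemma maze_parity i j : i <= m.*2 -> j <= m.*2 -> W i j -> odd i = odd j.
Proof.
move=> iM jM wij.
suff : odd (i + j) = odd (0 + 0) by rewrite oddD; case: (odd i); case: (odd j).
apply: (maze_white mW (f := fun i j => odd (i + j))) => //; last exact: maze00 mW.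
by split=> a b _ _ _ _; rewrite !oddD /=; case: (odd a); case: (odd b).
Qed.

Lemma maze02 : ~~ W 0 2.
Proof. by apply/negP => /(maze_in mW); lia. Qed.

(** Black cells with two odd coordinates and their side neighbours are cut off from the other black
    cells: a step out would reach a black cell with two even coordinates, spanning an all-black 2 by
    2 square with the odd cell. But the black border cell (0, 2) lies outside. *)
Lemma maze_odd i j : i <= m.*2 -> j <= m.*2 -> odd i -> odd j -> W i j.
Proof.
move=> iM jM oi oj; apply/negPn/negP => bij.
pose O a b := [&& odd a, odd b, a <= m.*2, b <= m.*2 & ~~ W a b].
(* At coordinate 0 the truncated predecessor is 0, which is even, so that [O] is false. *)
pose f a b := [|| O a b, O a.+1 b, O a.-1 b, O a b.+1 | O a b.-1].
have odd_sum a b : a <= m.*2 -> b <= m.*2 -> odd a != odd b -> ~~ W a b.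
  by move=> aM bM; apply: contra => /(maze_parity aM bM) ->.
(* The other two cells of the square have mixed parity, hence are black. *)
have sq a b a' b' : a <= m.*2 -> b <= m.*2 -> a' <= m.*2 -> b' <= m.*2 ->
   (a' == a.+1) || (a == a'.+1) -> (b' == b.+1) || (b == b'.+1) -> odd a -> odd b ->
   ~~ W a b -> ~~ W a' b' -> False.
  move=> aM bM aM' bM' aa bb oa ob wab wab'.
  have w1 : ~~ W a b' by apply: odd_sum => //; lia.
  have w2 : ~~ W a' b by apply: odd_sum => //; lia.
  case/orP: aa => /eqP aa; case/orP: bb => /eqP bb; subst.
  - by have := maze_square mW aM' bM'; rewrite (negbTE wab) (negbTE wab') (negbTE w1) (negbTE w2).
  - by have := maze_square mW aM' bM; rewrite (negbTE wab) (negbTE wab') (negbTE w1) (negbTE w2).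
  - by have := maze_square mW aM bM'; rewrite (negbTE wab) (negbTE wab') (negbTE w1) (negbTE w2).
  - by have := maze_square mW aM bM; rewrite (negbTE wab) (negbTE wab') (negbTE w1) (negbTE w2).
have : f i j = f 0 2; last by rewrite /f /O oi oj iM jM bij /=.
apply: (maze_black mW) => //; [|lia|exact: maze02].
split=> a b aM bM w1 w2.
- apply/idP/idP => /or4P[H|H|H|/orP[H|H]]; rewrite /f.
  + by rewrite /= H !orbT.
  + by rewrite H.
  + case/and5P: H => oa ob aM' bM' w; suff -> : O a.+1 b by [].
    by apply/and5P; split=> //; move: oa; case: (a) => //= a'; rewrite negbK.
  + case/and5P: H => oa ob aM' bM' w.
    by case: (@sq a b.+1 a.+1 b) => //; rewrite ?eqxx ?orbT //; lia.
  + case/and5P: H => oa ob aM' bM' w.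
    by case: (@sq a b.-1 a.+1 b) => //; rewrite ?eqxx ?orbT //; lia.
  + by rewrite H !orbT.
  + case/and5P: H => oa ob aM' bM' w; suff -> : O a b by [].
    by apply/and5P; split=> //; [move: oa; rewrite /= negbK|lia].
  + by rewrite H.
  + case/and5P: H => oa ob aM' bM' w.
    by case: (@sq a.+1 b.+1 a b) => //; rewrite ?eqxx ?orbT //; lia.
  + case/and5P: H => oa ob aM' bM' w.
    by case: (@sq a.+1 b.-1 a b) => //; rewrite ?eqxx ?orbT //; lia.
- apply/idP/idP => /or4P[H|H|H|/orP[H|H]]; rewrite /f.
  + by rewrite /= H !orbT.
  + case/and5P: H => oa ob aM' bM' w.
    by case: (@sq a.+1 b a b.+1) => //; rewrite ?eqxx ?orbT //; lia.
  + case/and5P: H => oa ob aM' bM' w.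
    by case: (@sq a.-1 b a b.+1) => //; rewrite ?eqxx ?orbT //; lia.
  + by rewrite H.
  + case/and5P: H => oa ob aM' bM' w; suff -> : O a b.+1 by [].
    by apply/and5P; split=> //; move: ob; case: (b) => //= a'; rewrite negbK.
  + by rewrite H !orbT.
  + case/and5P: H => oa ob aM' bM' w.
    by case: (@sq a.+1 b.+1 a b) => //; rewrite ?eqxx ?orbT //; lia.
  + case/and5P: H => oa ob aM' bM' w.
    by case: (@sq a.-1 b.+1 a b) => //; rewrite ?eqxx ?orbT //; lia.
  + case/and5P: H => oa ob aM' bM' w; suff -> : O a b by [].
    by apply/and5P; split=> //; [move: ob; rewrite /= negbK|lia].
  + by rewrite H.
Qed.

(** Otherwise the black cell between the two would also have white cells above and below, by
    [maze_odd], and be isolated. *)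
Lemma maze_half_hor i j : i < m -> j <= m -> W i.*2 j.*2 -> ~~ W i.+1.*2 j.*2.
Proof.
move=> im jm w1; apply/negP => w2.
have iM : i.*2.+2 <= m.*2 by lia.
have jM : j.*2 <= m.*2 by lia.
have j_in : 0 < j.*2 < m.*2.
  by rewrite doubleS in w2; have := maze_in mW iM jM w2; lia.
have w3 : W i.*2.+1 j.*2.+1 by apply: maze_odd; rewrite /= ?odd_double //; lia.
have w4 : W i.*2.+1 j.*2.-1.
  by apply: maze_odd; rewrite /= ?odd_double //; lia.
pose f a b := (a == i.*2.+1) && (b == j.*2).
have : f i.*2.+1 j.*2 = f 0 2; last by rewrite /f !eqxx.
apply: (maze_black mW) => //; try lia; last exact: maze02.
  split=> a b aM bM v1 v2; apply/andP/andP => -[/eqP ea /eqP eb]; exfalso; move: v1 v2.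
  - by rewrite ea eb -doubleS w2.
  - by case: ea => ->; rewrite eb w1.
  - by rewrite ea eb w3.
  - by rewrite ea (_ : b = j.*2.-1) ?w4 //; lia.
by apply: (maze_hor mW) w1; lia.
Qed.
End Halving.

(** For connectivity, colourings of the small maze are extended to the large one, each remaining
    cell copying a nearby even cell of its own kind. *)
Lemma maze_half m W : 0 < m -> maze m.*2 W -> maze m (fun i j => W i.*2 j.*2).
Proof.
move=> m0 mW.
have hor := maze_half_hor m0 mW.
have ver i j : i <= m -> j < m -> W i.*2 j.*2 -> ~~ W i.*2 j.+1.*2.
  by move=> im jm; apply: (maze_half_hor m0 (maze_tr mW)).
have oddW i j : i < m -> j < m -> W i.*2.+1 j.*2.+1.
  by move=> im jm; apply: (maze_odd m0 mW); rewrite /= ?odd_double //; lia.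
split=> //.
- exact: maze00 mW.
- by move=> i j im jm /(maze_in mW); lia.
- move=> i j im jm; apply/negPn/negP; rewrite !negb_or => /and4P[w1 w2 w3 w4].
  (* With four black corners, the white odd cell in the middle would be an isolated white cell. *)
  pose f a b := (a == i.*2.+1) && (b == j.*2.+1).
  have : f i.*2.+1 j.*2.+1 = f 0 0; last by rewrite /f !eqxx.
  apply: (maze_white mW) => //; try lia; [|exact: oddW|exact: maze00 mW].
  split=> a b aM bM v1 v2; apply/andP/andP => -[/eqP ea /eqP eb]; exfalso; move: v1 v2.
  + by rewrite ea eb -!doubleS (negbTE w4).
  + by case: ea => ->; case: eb => ->; rewrite (negbTE w1).
  + by case: ea => ->; rewrite eb -doubleS (negbTE w3).
  + by case: eb => ->; rewrite ea -doubleS (negbTE w2).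
- move=> f [f1 f2] i j i' j' im jm im' jm' w w'.
  (* A cell of mixed parity lies between two even cells, at least one of them black, and copies a
     black one. Cells with two odd coordinates are white, so their value is arbitrary. *)
  pose g a b := if odd a then if ~~ W a.-1 b then f a./2 b./2 else f a./2.+1 b./2
    else if odd b then if ~~ W a b.-1 then f a./2 b./2 else f a./2 b./2.+1
    else f a./2 b./2.
  have gE a b : g a.*2 b.*2 = f a b by rewrite /g !odd_double !doubleK.
  rewrite -(gE i j) -(gE i' j'); apply: (maze_black mW) => //; try lia.
  split=> a b aM bM v1 v2.
    have [ob|eb] := boolP (odd b).
      have [oa|ea] := boolP (odd a); first by rewrite (maze_odd m0 mW) // ltnW in v1.
      by rewrite (maze_odd m0 mW) in v2.
    have [x ax] := halves a; move: aM v1 v2; case: ax => -> aM v1 v2.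
      move: v1; rewrite -(even_halfK eb) => v1.
      by rewrite gE /g /= odd_double /= v1 /= !(doubleK, uphalf_double).
    move: v1 v2; rewrite -(even_halfK eb) => v1 v2.
    rewrite -doubleS gE /g /= odd_double /= !(doubleK, uphalf_double).
    by case: ifP => // w1; apply: f1 => //; lia.
  have [oa|ea] := boolP (odd a).
    have [ob|eb] := boolP (odd b); first by rewrite (maze_odd m0 mW) // ltnW in v1.
    by rewrite (maze_odd m0 mW) in v2.
  have [x bx] := halves b; move: bM v1 v2; case: bx => -> bM v1 v2.
    move: v1; rewrite -(even_halfK ea) => v1.
    by rewrite gE /g /= !odd_double /= v1 /= !(doubleK, uphalf_double).
  move: v1 v2; rewrite -(even_halfK ea) => v1 v2.
  rewrite -doubleS gE /g /= !odd_double /= !(doubleK, uphalf_double).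
  by case: ifP => // w1; apply: f2 => //; lia.
- move=> f [f1 f2] i j i' j' im jm im' jm' w w'.
  (* An odd cell copies its first white corner; two white corners of a square are diagonally
     opposite, so the choice is immaterial. *)
  pose g a b := if odd a then
      if W a.-1 b.-1 then f a./2 b./2 else if W a.+1 b.-1 then f a./2.+1 b./2
      else if W a.-1 b.+1 then f a./2 b./2.+1 else f a./2.+1 b./2.+1
    else f a./2 b./2.
  have gE a b : g a.*2 b.*2 = f a b by rewrite /g !odd_double !doubleK.
  rewrite -(gE i j) -(gE i' j'); apply: (maze_white mW) => //; try lia.
  have gO x y : g x.*2.+1 y.*2.+1 = if W x.*2 y.*2 then f x y else
      if W x.+1.*2 y.*2 then f x.+1 y else if W x.*2 y.+1.*2 then f x y.+1 else f x.+1 y.+1.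
    by rewrite /g /= odd_double /= !(doubleK, uphalf_double).
  have par a b : a <= m.*2 -> b <= m.*2 -> W a b -> odd a = odd b by apply: maze_parity.
  split=> a b aM bM v1 v2.
    have [x ax] := halves a; have [y b_y] := halves b.
    move: aM bM v1 v2; case: ax => ->; case: b_y => -> aM bM v1 v2.
    - by rewrite gE gO v1.
    - by have := par _ _ (ltnW aM) (ltnW bM) v1; rewrite /= !odd_double.
    - by have := par _ _ (ltnW aM) (ltnW bM) v1; rewrite /= !odd_double.
    rewrite -!doubleS in v2 *; rewrite gE gO; case: ifP => [w1|_]; first by apply: f1 => //; lia.
    case: ifP => [/ver w1|_]; first by rewrite (negbTE (w1 _ _)) in v2; lia.
    by case: ifP => [/hor w1|//]; rewrite (negbTE (w1 _ _)) in v2; lia.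
  have [x ax] := halves a; have [y b_y] := halves b.
    move: aM bM v1 v2; case: ax => ->; case: b_y => -> aM bM v1 v2.
  - by have := par _ _ aM (ltnW bM) v1; rewrite /= !odd_double.
  - rewrite -!doubleS in v2 *; rewrite gE gO; case: ifP => [/ver w1|_].
      by rewrite (negbTE (w1 _ _)) in v2; lia.
    by rewrite v2; case: ifP => // w1; apply: f2 => //; lia.
  - rewrite -!doubleS in v1 *; rewrite gE gO; case: ifP => [/hor w1|_].
      by rewrite (negbTE (w1 _ _)) in v1; lia.
    by rewrite v1.
  by have := par _ _ aM (ltnW bM) v1; rewrite /= !odd_double.
Qed.

Theorem maze_unique k W : maze (2 ^ k) W ->
  forall i j, i <= 2 ^ k -> j <= 2 ^ k -> W i j = pattern k i j.
Proof.
elim: k W => [|k IHk] W mW i j iM jM.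
  rewrite /=; apply/idP/idP => [/(maze_in mW iM jM)|/andP[/eqP-> /eqP->]]; last exact: maze00 mW.
  by rewrite expn0; lia.
have k0 : 0 < 2 ^ k by rewrite expn_gt0.
rewrite expnS mul2n in mW iM jM; rewrite /=.
have [oi|ei] := boolP (odd i).
  by apply/idP/idP => [/(maze_parity mW iM jM) <-|oj] //; apply: (maze_odd k0 mW).
have [oj|ej] /= := boolP (odd j).
  by apply/negP => /(maze_parity mW iM jM); rewrite oj (negbTE ei).
rewrite -(IHk _ (maze_half k0 mW)); try lia.
by rewrite !halfK (negbTE ei) (negbTE ej) !subn0.
Qed.

(** * From extremal polyominoes to mazes *)

Lemma nbrs_ge2 (Y : {fset cell}) (x v w : cell) : v \in dirs -> w \in dirs -> v != w ->
  (x + v)%R \in Y -> (x + w)%R \in Y -> 1 < nbrs Y x.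
Proof.
move=> vD wD vw xv xw; have wD' : w \in rem v dirs.
  by rewrite mem_rem_uniq //; apply/andP; rewrite /= eq_sym.
by rewrite /nbrs (big_rem v vD) (big_rem w wD') /= xv xw.
Qed.

Section Frame.
Variables (A H : {fset cell}) (M : nat) (z : cell) (e : int * int).
Hypotheses (M2 : 2 <= M) (cA : connected A) (fA : forest A).
Hypotheses (HA : forall c, c \in H -> c \notin A).
Hypotheses (HAu : forall c u, c \in H -> u \in dirs -> (c + u)%R \in A).
Hypotheses (e1 : (e.1 = 1 \/ e.1 = -1)%R) (e2 : (e.2 = 1 \/ e.2 = -1)%R).
Hypothesis FE : forall c, (c \in A `|` H) =
  [&& c != z, (c.1 == z.1 + e.1 * (absz (c.1 - z.1)%R)%:Z)%R, absz (c.1 - z.1)%R <= M,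
      (c.2 == z.2 + e.2 * (absz (c.2 - z.2)%R)%:Z)%R & absz (c.2 - z.2)%R <= M].

(** Coordinates with the missing corner as origin and axes pointing into the square. *)
Let p (i j : nat) : cell := (z.1 + e.1 * i%:Z, z.2 + e.2 * j%:Z)%R.
Let ix (c : cell) : nat := absz (c.1 - z.1)%R.
Let iy (c : cell) : nat := absz (c.2 - z.2)%R.
Let W i j := p i j \notin A.

Lemma frame_ix i j : ix (p i j) = i.
Proof. by rewrite /ix /p /=; case: e1 => ->; lia. Qed.

Lemma frame_iy i j : iy (p i j) = j.
Proof. by rewrite /iy /p /=; case: e2 => ->; lia. Qed.

Lemma frame_in c : c \in A `|` H -> exists i j, [/\ c = p i j, i <= M & j <= M].
Proof.
rewrite FE => /and5P[_ /eqP c1 ? /eqP c2 ?].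
by exists (ix c), (iy c); split=> //; apply: cell_ext.
Qed.

Lemma frame_p i j : i <= M -> j <= M -> (p i j \in A `|` H) = ((i, j) != (0, 0)).
Proof.
move=> iM jM; rewrite FE -/(ix _) -/(iy _) frame_ix frame_iy iM jM !eqxx !andbT /p.
case: z => a b; rewrite !xpair_eqE /=; case: e1 => ->; case: e2 => ->; lia.
Qed.

Lemma frame_stepx i j : p i.+1 j = (p i j + (e.1, 0))%R.
Proof. by apply: cell_ext; rewrite /p /= ?addr0 //; case: e1 => ->; lia. Qed.

Lemma frame_stepy i j : p i j.+1 = (p i j + (0, e.2))%R.
Proof. by apply: cell_ext; rewrite /p /= ?addr0 //; case: e2 => ->; lia. Qed.

Lemma frame_dx : (e.1, 0)%R \in dirs.
Proof. by case: e1 => ->. Qed.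

Lemma frame_dy : (0, e.2)%R \in dirs.
Proof. by case: e2 => ->. Qed.

Lemma frame_hole i j : i <= M -> j <= M -> W i j -> (i, j) != (0, 0) -> p i j \in H.
Proof. by move=> iM jM /negbTE wij; rewrite -frame_p // inE wij. Qed.

Lemma frame_interior i j : i <= M -> j <= M -> p i j \in H -> 0 < i < M /\ 0 < j < M.
Proof.
move=> iM jM pH; have inF u : u \in dirs -> (p i j + u)%R \in A `|` H.
  by move=> uD; rewrite inE HAu.
have [a [a' [a1 aM _]]] := frame_in (inF _ frame_dx).
have [b [b' [b1 bM _]]] := frame_in (inF _ (dirs_opp frame_dx)).
have [c [c' [c1 _ cM]]] := frame_in (inF _ frame_dy).
have [d [d' [d1 _ dM]]] := frame_in (inF _ (dirs_opp frame_dy)).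
move/(congr1 fst): a1; move/(congr1 fst): b1; move/(congr1 snd): c1; move/(congr1 snd): d1.
rewrite /p /=; case: e1 => ->; case: e2 => ->; lia.
Qed.

Lemma frame_W00 : W 0 0.
Proof.
by have := frame_p (leq0n M) (leq0n M); rewrite inE eqxx => /norP[].
Qed.

Lemma frame_W_in i j : i <= M -> j <= M -> W i j ->
  (i = 0 /\ j = 0) \/ (0 < i < M /\ 0 < j < M).
Proof.
move=> iM jM wij; have [[-> ->]|ij] := eqVneq (i, j) (0, 0); first by left.
by right; apply: frame_interior (frame_hole iM jM wij ij).
Qed.

Lemma frame_W_hor i j : i < M -> j <= M -> W i j -> ~~ W i.+1 j.
Proof.
move=> iM jM wij; have [[-> ->]|ij] := eqVneq (i, j) (0, 0).
  by apply/negP => /(frame_W_in (ltnW M2) (leq0n M)); lia.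
by rewrite /W frame_stepx negbK HAu ?frame_dx // frame_hole // ltnW.
Qed.

Lemma frame_W_ver i j : i <= M -> j < M -> W i j -> ~~ W i j.+1.
Proof.
move=> iM jM wij; have [[-> ->]|ij] := eqVneq (i, j) (0, 0).
  by apply/negP => /(frame_W_in (leq0n M) (ltnW M2)); lia.
by rewrite /W frame_stepy negbK HAu ?frame_dy // frame_hole // ltnW.
Qed.

(** Four tiles in a 2 by 2 square form a cycle, impossible in a forest. *)
Lemma frame_square i j : [|| W i j, W i.+1 j, W i j.+1 | W i.+1 j.+1].
Proof.
apply/negPn/negP; rewrite !negb_or !negbK => /and4P[w1 w2 w3 w4].
pose Y : {fset cell} := [fset p i j; p i.+1 j; p i j.+1; p i.+1 j.+1].
have YA : Y `<=` A by rewrite !fsubUset !fsub1set w1 w2 w3 w4.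
have Y0 : Y != fset0 by apply/fset0Pn; exists (p i j); rewrite !inE eqxx.
have [dx dy] := (frame_dx, frame_dy).
have mxy : (e.1, 0)%R != (0, e.2)%R :> cell by rewrite xpair_eqE; case: e1 => ->.
have [x xY] := fA YA Y0; apply/negP; rewrite -ltnNge.
move: xY; rewrite !inE -!orbA => /or4P[] /eqP->.
- by apply: (nbrs_ge2 dx dy) => //; rewrite -?frame_stepx -?frame_stepy !inE eqxx ?orbT.
- apply: (nbrs_ge2 (dirs_opp dx) dy).
  + by rewrite xpair_eqE /=; case: e1 => ->.
  + by rewrite frame_stepx addrK !inE eqxx.
  + by rewrite -frame_stepy !inE eqxx ?orbT.
- apply: (nbrs_ge2 dx (dirs_opp dy)).
  + by rewrite xpair_eqE /=; case: e1 => ->.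
  + by rewrite -frame_stepx !inE eqxx ?orbT.
  + by rewrite frame_stepy addrK !inE eqxx ?orbT.
- apply: (nbrs_ge2 (dirs_opp dx) (dirs_opp dy)).
  + by rewrite xpair_eqE /=; case: e1 => ->.
  + by rewrite frame_stepx addrK !inE eqxx ?orbT.
  + by rewrite frame_stepy addrK !inE eqxx ?orbT.
Qed.

Lemma frame_black f : black_const M W f -> forall i j i' j',
  i <= M -> j <= M -> i' <= M -> j' <= M -> ~~ W i j -> ~~ W i' j' -> f i j = f i' j'.
Proof.
move=> [f1 f2] i j i' j' iM jM iM' jM'; rewrite /W !negbK => w w'.
have := cA (f := fun c => f (ix c) (iy c)) _ w' w; rewrite !frame_ix !frame_iy; apply.
move=> c u cA' uD cuA.
have [a [b [c1 cx cy]]] : exists a b, [/\ c = p a b, a <= M & b <= M].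
  by apply: frame_in; rewrite inE cA'.
have [a' [b' [d1 dx dy]]] : exists a' b', [/\ (c + u)%R = p a' b', a' <= M & b' <= M].
  by apply: frame_in; rewrite inE cuA.
have wc : ~~ W a b by rewrite /W negbK -c1.
have wd : ~~ W a' b' by rewrite /W negbK -d1.
have : (a' = a /\ (b' = b.+1 \/ b = b'.+1)) \/ (b' = b /\ (a' = a.+1 \/ a = a'.+1)).
  have d2 : p a' b' = (p a b + u)%R by rewrite -c1.
  move/(congr1 fst): (d2); move/(congr1 snd): d2; rewrite /p /=.
  by move: uD; rewrite !inE => /or4P[] /eqP->; case: e1 => ->; case: e2 => -> /=; lia.
rewrite d1 c1 !frame_ix !frame_iy.
by case=> -[E [E'|E']]; subst; [apply/esym/f2|apply/f2|apply/esym/f1|apply/f1].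
Qed.

(** The outside of the square gets the colour of the missing corner, and [forest_king_constant]
    applies: holes are interior, so a king move from one stays in the square, and it is diagonal if
    it changes cell. *)
Lemma frame_white f : white_const M W f -> forall i j i' j',
  i <= M -> j <= M -> i' <= M -> j' <= M -> W i j -> W i' j' -> f i j = f i' j'.
Proof.
move=> [f1 f2] i j i' j' iM jM iM' jM' w w'.
pose g c := if c \in H then f (ix c) (iy c) else f 0 0.
have gp a b : a <= M -> b <= M -> W a b -> g (p a b) = f a b.
  move=> aM bM wab; rewrite /g frame_ix frame_iy; case: ifP => // /negbT nH.
  have := frame_p aM bM; rewrite inE (negbTE nH) (negbTE wab) => /esym/negbFE.
  by rewrite xpair_eqE => /andP[/eqP-> /eqP->].
rewrite -(gp i j) // -(gp i' j') //; apply: (forest_king_constant fA) => //.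
have key c d : c \in H -> d \notin A -> king c d -> g c = g d.
  move=> cH dA cd.
  have [a [b [c1 cx cy]]] : exists a b, [/\ c = p a b, a <= M & b <= M].
    by apply: frame_in; rewrite inE cH orbT.
  have [aM bM] : 0 < a < M /\ 0 < b < M by apply: frame_interior; rewrite -?c1.
  have wc : W a b by rewrite /W -c1 HA.
  have [a' [b' [d1 ab]]] : exists a' b', d = p a' b' /\
     [&& a' <= a.+1, a <= a'.+1, b' <= b.+1 & b <= b'.+1].
    exists (ix d), (iy d); move: cd; rewrite c1 /king /ix /iy /p /= => cd.
    split; last by move: cd; case: e1 => ->; case: e2 => ->; lia.
    by apply: cell_ext => /=; move: cd aM bM; case: e1 => ->; case: e2 => ->; lia.
  case/and4P: ab => ab1 ab2 ab3 ab4.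
  have aM' : a' <= M by lia.
  have bM' : b' <= M by lia.
  have wd : W a' b' by rewrite /W -d1.
  rewrite c1 d1 !gp //; try lia.
  have : (a' = a \/ a' = a.+1 \/ a = a'.+1) /\ (b' = b \/ b' = b.+1 \/ b = b'.+1) by lia.
  case=> -[Ea|[Ea|Ea]] [Eb|[Eb|Eb]]; move: wc wd.
  - by rewrite Ea Eb.
  - by rewrite Ea Eb => /frame_W_ver w1; rewrite (negbTE (w1 _ _)) //; lia.
  - by rewrite Ea Eb => + /frame_W_ver w1; rewrite (negbTE (w1 _ _)) //; lia.
  - by rewrite Ea Eb => /frame_W_hor w1; rewrite (negbTE (w1 _ _)) //; lia.
  - by rewrite Ea Eb => wc wd; apply: f1 => //; lia.
  - by rewrite Ea Eb => wc wd; apply/esym/f2 => //; lia.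
  - by rewrite Ea Eb => + /frame_W_hor w1; rewrite (negbTE (w1 _ _)) //; lia.
  - by rewrite Ea Eb => wc wd; apply: f2 => //; lia.
  - by rewrite Ea Eb => wc wd; apply/esym/f1 => //; lia.
move=> c d cA' dA cd; case: (boolP (c \in H)) => [cH|cH]; first exact: key.
case: (boolP (d \in H)) => [dH|dH]; first by rewrite (key d c) // king_sym.
by rewrite /g (negbTE cH) (negbTE dH).
Qed.

Lemma frame_maze : maze M W.
Proof.
split; [exact: frame_W00|exact: frame_W_in|exact: frame_W_hor|exact: frame_W_ver| | |].
- by move=> i j _ _; apply: frame_square.
- exact: frame_black.
- exact: frame_white.
Qed.
End Frame.

Lemma extremal_maze (A : {fset cell}) (M h : nat) : 2 <= M -> 3 * h + 1 = M ^ 2 ->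
  polyomino A -> num_holes A h -> #|` A| + h <= M ^ 2 + 2 * M ->
  #|` A| + h = M ^ 2 + 2 * M /\ exists (sx sy : bool) (z : cell),
    maze M (fun i j => isom false sx sy z (i%:Z, j%:Z)%R \notin A) /\
    forall c, c \in A -> exists i j, [/\ i <= M, j <= M & c = isom false sx sy z (i%:Z, j%:Z)%R].
Proof.
move=> M2 hM pA nA cardA.
have [H [z [e [[HA HAu fA] eA e1 e2 FE]]]] := extremal_corner M2 hM pA nA cardA.
(* An axis with sign -1 becomes a reflection of the isometry. *)
split=> //; exists (e.1 == -1)%R, (e.2 == -1)%R, z.
have E i j : isom false (e.1 == -1)%R (e.2 == -1)%R z (i%:Z, j%:Z)%R =
    (z.1 + e.1 * i%:Z, z.2 + e.2 * j%:Z)%R.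
  by apply: cell_ext; rewrite /isom /=; [case: e1 => ->|case: e2 => ->]; rewrite /=; lia.
split=> [|c cA].
  have := frame_maze M2 (polyomino_connected pA) fA HA HAu e1 e2 FE.
  congr maze; apply/funext => i; apply/funext => j; by rewrite E.
have [] := @frame_in A H M z e FE c; first by rewrite inE cA.
by move=> i [j [cE iM jM]]; exists i, j; rewrite E.
Qed.

(** * The crystallized polyomino *)

Lemma pattern00 k : pattern k 0 0.
Proof. by elim: k. Qed.

Lemma pattern_hor k i j : pattern k i j -> ~~ pattern k i.+1 j.
Proof. by case: k => [|k] /=; [case: i | case: (odd i); case: (odd j)]. Qed.

Lemma pattern_ver k i j : pattern k i j -> ~~ pattern k i j.+1.
Proof. by case: k => [|k] /=; [case: i; case: j | case: (odd i); case: (odd j)]. Qed.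

Lemma pattern_in k i j : i <= 2 ^ k -> j <= 2 ^ k -> pattern k i j ->
  (i = 0 /\ j = 0) \/ (0 < i < 2 ^ k /\ 0 < j < 2 ^ k).
Proof.
elim: k i j => [|k IHk] i j; first by rewrite /= => _ _ /andP[/eqP-> /eqP->]; left.
rewrite expnS /= => iM jM; case: (boolP (odd i)) => [oi oj|ei /andP[ej]].
  by right; lia.
by move/IHk; lia.
Qed.

(** Induction by halving: the mixed cells, all black, link consecutive black even cells ([half]),
    and each touches a black even cell ([rep]). *)
Lemma pattern_black k f : black_const (2 ^ k) (pattern k) f -> forall i j i' j',
  i <= 2 ^ k -> j <= 2 ^ k -> i' <= 2 ^ k -> j' <= 2 ^ k ->
  ~~ pattern k i j -> ~~ pattern k i' j' -> f i j = f i' j'.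
Proof.
elim: k f => [|k IHk] f [f1 f2].
  have e1 : f 1 0 = f 1 1 by apply: f2.
  have e2 : f 0 1 = f 1 1 by apply: f1.
  rewrite expn0; move=> [|[|i]] [|[|j]] [|[|i']] [|[|j']] //= _ _ _ _ _ _;
  by rewrite ?e1 ?e2.
rewrite expnS mul2n in f1 f2 *.
have patE a b : pattern k.+1 a.*2 b.*2 = pattern k a b by rewrite /= !odd_double !doubleK.
have pat_x a b : ~~ pattern k.+1 a.*2.+1 b.*2 by rewrite /= !odd_double.
have pat_y a b : ~~ pattern k.+1 a.*2 b.*2.+1 by rewrite /= !odd_double.
have half i j i' j' : i <= 2 ^ k -> j <= 2 ^ k -> i' <= 2 ^ k -> j' <= 2 ^ k ->
    ~~ pattern k i j -> ~~ pattern k i' j' -> f i.*2 j.*2 = f i'.*2 j'.*2.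
  apply: (IHk (fun i j => f i.*2 j.*2)); split=> a b aM bM w1 w2.
    rewrite (f1 a.*2 b.*2) ?patE ?pat_x //; try lia.
    by rewrite (f1 a.*2.+1 b.*2) -?doubleS ?patE ?pat_x //; lia.
  rewrite (f2 a.*2 b.*2) ?patE ?pat_y //; try lia.
  by rewrite (f2 a.*2 b.*2.+1) -?doubleS ?patE ?pat_y //; lia.
have rep i j : i <= (2 ^ k).*2 -> j <= (2 ^ k).*2 -> ~~ pattern k.+1 i j ->
    exists a b, [/\ a <= 2 ^ k, b <= 2 ^ k, ~~ pattern k a b & f i j = f a.*2 b.*2].
  have [a ia] := halves i; have [b jb] := halves j.
  case: ia => ->; case: jb => -> iM jM w.
  - by exists a, b; split=> //; [lia|lia|rewrite -patE].
  - have [w1|w1] := boolP (pattern k a b); last first.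
      by exists a, b; split=> //; [lia|lia|apply/esym/f2; rewrite ?patE //; lia].
    have w2 := pattern_ver w1.
    exists a, b.+1; split=> //; try lia.
    by rewrite doubleS; apply: f2; rewrite -?doubleS ?patE //; lia.
  - have [w1|w1] := boolP (pattern k a b); last first.
      by exists a, b; split=> //; [lia|lia|apply/esym/f1; rewrite ?patE //; lia].
    have w2 := pattern_hor w1.
    exists a.+1, b; split=> //; try lia.
    by rewrite doubleS; apply: f1; rewrite -?doubleS ?patE //; lia.
  by move: w; rewrite /= !odd_double.
move=> i j i' j' iM jM iM' jM' w w'.
have [a [b [aM bM wab ->]]] := rep i j iM jM w.
have [a' [b' [aM' bM' wab' ->]]] := rep i' j' iM' jM' w'.
exact: half.
Qed.

(** The recursion of [pattern] as a list, for counting the holes and the corner. *)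
Fixpoint whites (k : nat) : seq (nat * nat) :=
  if k is k'.+1 then
    [seq (a.*2.+1, b.*2.+1) | a <- iota 0 (2 ^ k'), b <- iota 0 (2 ^ k')] ++
    [seq (c.1.*2, c.2.*2) | c <- whites k']
  else [:: (0, 0)].

Lemma mem_whites k i j :
  ((i, j) \in whites k) = [&& i <= 2 ^ k, j <= 2 ^ k & pattern k i j].
Proof.
elim: k i j => [|k IHk] i j; first by rewrite /= inE xpair_eqE expn0; lia.
rewrite [whites _]/= mem_cat expnS mul2n; apply/orP/and3P.
  case=> [/allpairsP[[a b] /=]|/mapP[[a b] /=]].
    by rewrite !mem_iota /= => -[aM bM [-> ->]]; rewrite /= !odd_double; split=> //; lia.
  by rewrite IHk => /and3P[aM bM w] [-> ->]; rewrite /= !odd_double !doubleK w; split=> //; lia.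
rewrite /=; case: ifP => [oi [iM jM oj]|ei [iM jM /andP[ej w]]]; [left|right].
  apply/allpairsP; exists (i./2, j./2); rewrite /= !mem_iota.
  by split; [lia|lia|congr (_, _); lia].
apply/mapP; exists (i./2, j./2); first by rewrite IHk w; lia.
by rewrite /= !even_halfK // ei.
Qed.

Lemma whites_uniq k : uniq (whites k).
Proof.
elim: k => //= k IHk; rewrite cat_uniq; apply/and3P; split.
- by apply: allpairs_uniq; rewrite ?iota_uniq // => -[a b] [a' b'] _ _ /= [] ? ?; congr (_, _); lia.
- apply/hasPn => _ /mapP[c _ ->]; apply/allpairsP => -[[a b] /= [_ _ []]]; lia.
- by rewrite map_inj_uniq // => -[a b] [a' b'] /= [] ? ?; congr (_, _); lia.
Qed.

Lemma size_whites k : 3 * size (whites k) = 2 ^ (2 * k) + 2.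
Proof.
elim: k => // k IHk; rewrite /= size_cat size_allpairs size_map !size_iota mulnDr IHk.
by rewrite -expnD addnn -mul2n mulnS expnD; lia.
Qed.

Definition cell_of (c : nat * nat) : cell := (c.1%:Z, c.2%:Z)%R.

Lemma cell_of_inj : injective cell_of.
Proof. by move=> [a b] [c d] [-> ->]. Qed.

Definition square (k : nat) : {fset nat * nat} :=
  seq_fset tt [seq (i, j) | i <- iota 0 (2 ^ k).+1, j <- iota 0 (2 ^ k).+1].

Definition tiles (k : nat) : {fset cell} :=
  [fset cell_of c | c in square k `\` seq_fset tt (whites k)].

Lemma in_square k i j : ((i, j) \in square k) = (i <= 2 ^ k) && (j <= 2 ^ k).
Proof.
rewrite seq_fsetE; apply/allpairsP/andP => [[[a b] []]|[iM jM]].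
  by rewrite !mem_iota /= => ? ? [-> ->]; lia.
by exists (i, j); split; rewrite // mem_iota /=; lia.
Qed.

Lemma tilesP k c : reflect
  (exists i j, [/\ i <= 2 ^ k, j <= 2 ^ k, ~~ pattern k i j & c = cell_of (i, j)])
  (c \in tiles k).
Proof.
have SE i j : ((i, j) \in square k `\` seq_fset tt (whites k)) =
    [&& i <= 2 ^ k, j <= 2 ^ k & ~~ pattern k i j].
  rewrite in_fsetD in_square seq_fsetE mem_whites.
  by case: (i <= _); case: (j <= _); case: (pattern k i j).
rewrite /tiles; move: (_ `\` _) SE => S SE.
apply: (iffP (imfsetP _ _ _ _)) => /= [[[i j]]|[i [j [iM jM w ->]]]].
  by rewrite SE => /and3P[iM jM w] ->; exists i, j.
by exists (i, j); rewrite // SE iM jM.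
Qed.

Lemma in_tiles k i j : i <= 2 ^ k -> j <= 2 ^ k ->
  (cell_of (i, j) \in tiles k) = ~~ pattern k i j.
Proof.
move=> iM jM; apply/tilesP/idP => [[a [b [_ _ w /cell_of_inj[-> ->]]]]//|w].
by exists i, j.
Qed.

Lemma card_tiles k : #|` tiles k| + size (whites k) = (2 ^ k).+1 ^ 2.
Proof.
have sub : seq_fset tt (whites k) `<=` square k.
  by apply/fsubsetP => -[i j]; rewrite seq_fsetE mem_whites in_square => /and3P[-> ->].
rewrite /tiles card_imfset /=; last exact: cell_of_inj.
have -> : size (whites k) = #|` seq_fset tt (whites k)|.
  by rewrite size_seq_fset undup_id ?whites_uniq.
rewrite cardfsDS // subnK ?fsubset_leq_card // size_seq_fset undup_id.
  by rewrite size_allpairs size_iota mulnn.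
by apply: allpairs_uniq; rewrite ?iota_uniq // => -[a b] [a' b'] _ _ /= [-> ->].
Qed.

Lemma tiles_polyomino k : polyomino (tiles k).
Proof.
split; first by apply/fset0Pn; exists (cell_of (1, 0)); rewrite in_tiles ?expn_gt0 //; case: k.
apply: (@colour_conn (mem (tiles k))) => f fA p q /tilesP[i [j [iM jM w ->]]].
move=> /tilesP[i' [j' [iM' jM' w' ->]]].
apply: (@pattern_black k (fun i j => f (cell_of (i, j)))) => //.
have stepx a b : cell_of (a.+1, b) = (cell_of (a, b) + (1, 0))%R.
  by apply: cell_ext; rewrite /= ?addr0 //; lia.
have stepy a b : cell_of (a, b.+1) = (cell_of (a, b) + (0, 1))%R.
  by apply: cell_ext; rewrite /= ?addr0 //; lia.
split=> a b aM bM w1 w2; [rewrite stepx|rewrite stepy]; apply/esym/fA; rewrite -?stepx -?stepy //=.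
- by rewrite in_tiles // ltnW.
- by rewrite in_tiles.
- by rewrite in_tiles // ltnW.
- by rewrite in_tiles.
Qed.

(** Each white cell but the corner is a hole by itself, its four neighbours being tiles; every other
    free cell starts a free ray and is not enclosed. *)
Lemma tiles_holes k : num_holes (tiles k) (size (whites k)).-1.
Proof.
pose holes := rem (0, 0) (whites k).
have w0 : (0, 0) \in whites k by rewrite mem_whites pattern00.
have in_holes i j : ((i, j) \in holes) =
    [&& 0 < i < 2 ^ k, 0 < j < 2 ^ k & pattern k i j].
  rewrite mem_rem_uniq ?whites_uniq // inE /= mem_whites xpair_eqE.
  apply/andP/and3P => [[+ /and3P[iM jM w]]|[iM jM w]].
    by have [[-> ->]//|[]] := pattern_in iM jM w.
  by rewrite w; lia.
have nbr i j u : (i, j) \in holes -> u \in dirs -> (cell_of (i, j) + u)%R \in tiles k.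
  rewrite in_holes => /and3P[iM jM w]; rewrite !inE => /or4P[] /eqP->.
  - rewrite (_ : (_ + _)%R = cell_of (i.+1, j)) ?in_tiles ?pattern_hor //; try lia.
    by apply: cell_ext => /=; lia.
  - rewrite (_ : (_ + _)%R = cell_of (i.-1, j)) ?in_tiles //; try lia.
      by apply: contraL w => /pattern_hor; rewrite prednK //; lia.
    by apply: cell_ext => /=; lia.
  - rewrite (_ : (_ + _)%R = cell_of (i, j.+1)) ?in_tiles ?pattern_ver //; try lia.
    by apply: cell_ext => /=; lia.
  - rewrite (_ : (_ + _)%R = cell_of (i, j.-1)) ?in_tiles //; try lia.
      by apply: contraL w => /pattern_ver; rewrite prednK //; lia.
    by apply: cell_ext => /=; lia.
have isolated c d : c \in holes -> conn (compl (tiles k)) (cell_of c) d -> d = cell_of c.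
  case: c => i j cH cd; apply/eqP; move: cd.
  have col : forall p u, compl (tiles k) p -> u \in dirs -> compl (tiles k) (p + u)%R ->
      ((p + u)%R == cell_of (i, j)) = (p == cell_of (i, j)).
    move=> p u pA uD puA; apply/eqP/eqP => E.
      have := nbr _ _ _ cH (dirs_opp uD); rewrite -E addrK => pT.
      by move: pA; rewrite /compl pT.
    by move: puA; rewrite E /compl nbr.
  by move/(conn_colour (f := fun p => p == cell_of (i, j)) col) => ->.
have free_ray c u : u \in dirs -> (forall n, (c + u *+ n)%R \notin tiles k) ->
    ~ enclosed (tiles k) c.
  move=> uD ray [_ [N bN]].
  have reach n : conn (compl (tiles k)) c (c + u *+ n)%R.
    elim: n => [|n IHn]; first by have := ray 0; rewrite mulr0n addr0; apply: conn_refl.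
    apply: conn_trans IHn _; have := ray n.+1; rewrite mulrSr addrA => ray'.
    by apply: conn_step => //; apply: ray.
  have := bN _ (reach (N + absz c.1 + absz c.2).+1); rewrite cell_mulrn /=.
  by move: uD; rewrite !inE => /or4P[] /eqP-> /=; lia.
exists [seq cell_of c | c <- holes]; split.
- by rewrite size_map size_rem.
- move=> _ /mapP[[i j] cH ->]; have := cH; rewrite in_holes => /and3P[iM jM w].
  split; first by rewrite in_tiles ?w //; lia.
  by exists (i + j) => d /(isolated _ _ cH) ->; rewrite /=; lia.
- have sz : size holes = (size (whites k)).-1 by rewrite size_rem.
  move=> i j ih jh ij; rewrite -sz in ih jh.
  rewrite !(nth_map (0, 0)) // => /(isolated _ _ (mem_nth _ ih))/cell_of_inj/eqP.
  by rewrite nth_uniq ?rem_uniq ?whites_uniq // => /eqP E; apply: ij.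
- move=> c ec; have [cT _] := ec.
  have out u : u \in dirs -> (forall n i j, i <= 2 ^ k -> j <= 2 ^ k ->
      (c + u *+ n)%R = cell_of (i, j) -> pattern k i j) -> False.
    move=> uD uout; apply: (free_ray c u uD) ec => n; apply/negP => /tilesP[i [j [iM jM w E]]].
    by rewrite (uout n i j iM jM E) in w.
  have [c1|c1] := ltP c.1 0%R.
    case: (out (-1, 0)%R isT) => n i j _ _; rewrite cell_mulrn /= => /(congr1 fst) /=; lia.
  have [c2|c2] := ltP c.2 0%R.
    case: (out (0, -1)%R isT) => n i j _ _; rewrite cell_mulrn /= => /(congr1 snd) /=; lia.
  have [c3|c3] := ltP (Posz (2 ^ k)) c.1.
    case: (out (1, 0)%R isT) => n i j iM _; rewrite cell_mulrn /= => /(congr1 fst) /=; lia.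
  have [c4|c4] := ltP (Posz (2 ^ k)) c.2.
    case: (out (0, 1)%R isT) => n i j _ jM; rewrite cell_mulrn /= => /(congr1 snd) /=; lia.
  have cE : c = cell_of (absz c.1, absz c.2) by apply: cell_ext => /=; lia.
  have w : pattern k (absz c.1) (absz c.2).
    by move: cT; rewrite cE in_tiles ?negbK //; lia.
  have c1M : absz c.1 <= 2 ^ k by lia.
  have c2M : absz c.2 <= 2 ^ k by lia.
  have [[z1 z2]|[z1 z2]] := pattern_in c1M c2M w.
    (* The ray from the missing corner meets the square only at its start, which is white. *)
    case: (out (-1, 0)%R isT) => n i j _ _; rewrite cell_mulrn /= cE z1 z2.
    move=> E; have := congr1 fst E; have := congr1 snd E; rewrite /= => E1 E2.
    have [-> ->] : i = 0 /\ j = 0 by move: E1 E2; lia.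
    exact: pattern00.
  exists c; last exact: conn_refl.
  by apply/mapP; exists (absz c.1, absz c.2) => //; rewrite in_holes w; lia.
Qed.

Theorem theorem6 (l : nat) : (1 <= l)%N ->
  exists A : {fset cell},
    crystallized ((2 ^ (2 * l) - 1) %/ 3) A /\
    forall B : {fset cell}, crystallized ((2 ^ (2 * l) - 1) %/ 3) B -> free_equiv A B.
Proof.
move=> l1; set h := _ %/ 3.
have hW : h = (size (whites l)).-1 by have := size_whites l; rewrite /h; lia.
have M2 : 2 <= 2 ^ l by rewrite -[2]expn1 leq_exp2l.
have hM : 3 * h + 1 = (2 ^ l) ^ 2.
  by have := size_whites l; have := expn_gt0 2 (2 * l); rewrite -expnM [l * 2]mulnC /h; lia.
have cT : #|` tiles l| + h = (2 ^ l) ^ 2 + 2 * 2 ^ l.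
  have := card_tiles l; have := size_whites l.
  by rewrite -expnM [l * 2]mulnC hW -[(2 ^ l).+1]addn1 sqrnD -expnM [l * 2]mulnC; lia.
exists (tiles l); split.
  split; [exact: tiles_polyomino|by rewrite hW; apply: tiles_holes|].
  move=> B pB hB; rewrite leqNgt; apply/negP => ltB.
  (* A smaller [B] satisfies the size hypothesis of [extremal_maze], whose conclusion is
     equality. *)
  by have [] := extremal_maze M2 hM pB hB; lia.
move=> B [pB hB minB].
have leB : #|` B| <= #|` tiles l|.
  by apply: minB; [exact: tiles_polyomino|rewrite hW; apply: tiles_holes].
have [|_ [sx [sy [z [mB Bin]]]]] := extremal_maze M2 hM pB hB; first by lia.
have inB := maze_unique mB.
exists false, sx, sy, z; apply/fsetP => c; apply/idP/imfsetP => /= [cB|[d + ->]].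
  have [i [j [iM jM cE]]] := Bin c cB; exists (cell_of (i, j)) => //.
  by rewrite in_tiles // -inB // negbK -cE.
by case/tilesP=> i [j [iM jM w ->]]; move: w; rewrite -inB // negbK.
Qed.
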